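(* (Classification of rings whose unit group is an elementary abelian $2$-group.) The following four statements hold. (1) Let $k$ be a field and let $R$ be a finite-dimensional commutative $k$-algebra. Then $R$ is a $\Delta_2$-ring if and only if $R$ is isomorphic to a finite product of rings that are either $\mathbb{F}_3$ or a quotient of a truncated polynomial ring of the form $\mathbb{F}_2[x_1,\ldots,x_l]/(x_1^2,\ldots,x_l^2)$, $l\ge 1$. (2) Let $R$ be a finite commutative ring. Then $R$ is a $\Delta_2$-ring if and only if $R$ is isomorphic to a quotient of a finite product of rings $R_i$, where each $R_i$ is any of the following rings: (a) $\mathbb{F}_2[x_1,\ldots,x_l]/(x_1^2,\ldots,x_l^2)$, $l\ge 1$; (b) $\mathbb{F}_3$; (c) $\mathbb{Z}_4[x_1,\ldots,x_l]/(r(r+2) : r\in\mathcal{P})$, where $\mathcal{P}=(2,x_1-1,\ldots,x_l-1)\subseteq \mathbb{Z}_4[x_1,\ldots,x_l]$; (d) $\mathbb{Z}_8[x_1,\ldots,x_l]/(r(r+2) : r\in\mathcal{P})$, where $\mathcal{P}=(2,x_1-1,\ldots,x_l-1)\subseteq \mathbb{Z}_8[x_1,\ldots,x_l]$. (3) Let $n$ be a positive integer and let $G$ be a finite group. Then the group ring $\mathbb{Z}_nG$ is a $\Delta_2$-ring if and only if either $n\in\{2,3,6\}$ and $G$ is an elementary abelian $2$-group, or $n\in\{4,12\}$ and $G=C_2$. (4) Let $k$ be a field and let $Q$ be a finite and acyclic quiver. Then the path algebra $kQ$ is a $\Delta_2$-ring if and only if either $k=\mathbb{F}_3$ and $Q$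 is trivial, or $k=\mathbb{F}_2$ and $Q$ has no directed path of length $2$.
   Context: All rings are associative with identity. For a prime $p$, a ring $R$ is called a $\Delta_p$-ring if every unit $u\in R^\times$ satisfies $u^p=1$; for $p=2$ this is equivalent to $R^\times$ being an elementary abelian $2$-group. $\mathbb{Z}_n$ denotes $\mathbb{Z}/n\mathbb{Z}$, $\mathbb{F}_q$ the field with $q$ elements, $C_m$ the cyclic group of order $m$. An elementary abelian $p$-group is a direct sum of copies of $C_p$. The notation $(r(r+2): r\in\mathcal{P})$ means the ideal generated by all elements $r(r+2)$ with $r\in\mathcal{P}$. The number of variables $l$ may vary from factor to factor. A quiver $Q$ is a directed, not necessarily simple, graph; it is acyclic if it has no directed cycles, and trivial if it has no edges. The path algebra $kQ$ is the $k$-vector space with basis the directed paths in $Q$, including for each vertex $i$ a path $e_i$ of length $0$ at $i$. For two paths $a,b$, the product $ab$ is the concatenation ($b$ followed by $a$) if $b$ ends at the vertex where $a$ starts, and $0$ otherwise.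
   Formalization: In (3), n=1 is excluded, as is G trivial with n in {4,8,12,24}, because the ring is then a Δ_2-ring but the stated condition fails; in (4), Q is required to have at least one vertex, since otherwise kQ=0 is a Δ_2-ring for every field k. *)

(* Defs.v *)
From HB Require Import structures.
From mathcomp Require Import all_boot all_order all_fingroup all_algebra all_solvable.
From mathcomp Require Import finmap boolp.
From mathcomp Require Import mpoly.
From mathcomp Require monalg.

Set Implicit Arguments.
Unset Strict Implicit.
Unset Printing Implicit Defensive.

Import GRing.Theory.
Local Open Scope ring_scope.
Local Open Scope quotient_scope.

(* Rings are associative and unital; the zero ring is allowed (pzRingType).
   Units are two-sided; no choice of an inverse function is required.         *)

Definition is_unit (R : pzRingType) (u : R) : Prop :=
  exists v : R, u * v = 1 /\ v * u = 1.

Definition Delta_ring (p : nat) (R : pzRingType) : Prop :=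
  forall u : R, is_unit u -> u ^+ p = 1.

Definition ring_iso (R S : pzRingType) : Prop :=
  exists f : {rmorphism R -> S}, bijective f.

(* The library's {ideal_quot I} is restricted to proper decidable ideals; here
   the ideal generated by an arbitrary subset S is decided classically, and the
   quotient may be the zero ring.                                             *)

Section GeneratedIdeal.
Variables (R : comPzRingType) (S : R -> Prop).

Definition gen_ideal (x : R) : Prop :=
  exists (n : nat) (a s : 'I_n -> R),
    (forall i, S (s i)) /\ x = \sum_(i < n) a i * s i.

Lemma gen_idealMD a x y : gen_ideal x -> gen_ideal y -> gen_ideal (a * x + y).
Proof.
move=> [n [b [s [Ss ->]]]] [m [c [t [St ->]]]].
exists (n + m)%N, (fun i => match split i with inl j => a * b j | inr j => c j end).
exists (fun i => match split i with inl j => s j | inr j => t j end); split.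
  by move=> i; case: (split i).
rewrite big_split_ord /= mulr_sumr; congr (_ + _); apply: eq_bigr => i _.
  by rewrite (unsplitK (inl _ i)) mulrA.
by rewrite (unsplitK (inr _ i)).
Qed.

Lemma gen_ideal0 : gen_ideal 0.
Proof.
by exists 0%N, (fun=> 0), (fun=> 0); split=> [[]|] //; rewrite big_ord0.
Qed.

Definition gen_idealb : {pred R} := fun x => `[< gen_ideal x >].

Lemma gen_idealP x : reflect (gen_ideal x) (x \in gen_idealb).
Proof. exact: asboolP. Qed.

Lemma gen_idealb_zmod : zmod_closed gen_idealb.
Proof.
split=> [|x y /gen_idealP Ix /gen_idealP Iy]; apply/gen_idealP.
  exact: gen_ideal0.
by rewrite addrC -mulN1r; apply: gen_idealMD.
Qed.

HB.instance Definition _ := GRing.isZmodClosed.Build R gen_idealb gen_idealb_zmod.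

Lemma gen_idealbM a x : x \in gen_idealb -> a * x \in gen_idealb.
Proof.
move=> /gen_idealP Ix; apply/gen_idealP.
by rewrite -[_ * _]addr0; apply: gen_idealMD => //; apply: gen_ideal0.
Qed.

Definition quot_ring : Type := Quotient.quot gen_idealb.
HB.instance Definition _ := GRing.Zmodule.on quot_ring.
HB.instance Definition _ := EqQuotient.on quot_ring.

Definition quot_one : quot_ring := \pi_quot_ring 1.
Definition quot_mul (x y : quot_ring) : quot_ring :=
  \pi_quot_ring (generic_quotient.repr x * generic_quotient.repr y).

Lemma quot_piM x y :
  quot_mul (\pi_quot_ring x) (\pi_quot_ring y) = \pi_quot_ring (x * y).
Proof.
apply/eqP; rewrite -Quotient.idealrBE.
set x' := generic_quotient.repr _; set y' := generic_quotient.repr _.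
have Ix : x' - x \in gen_idealb by rewrite Quotient.idealrBE reprK.
have Iy : y' - y \in gen_idealb by rewrite Quotient.idealrBE reprK.
rewrite -[x' * y'](subrK (x * y')) -mulrBl -addrA -mulrBr.
by apply: rpredD; last exact: gen_idealbM; rewrite mulrC; apply: gen_idealbM.
Qed.

Lemma quot_piD x y : \pi_quot_ring x + \pi_quot_ring y = \pi_quot_ring (x + y).
Proof. by rewrite [RHS]Quotient.pi_add. Qed.

Lemma quot_piP (x : quot_ring) : exists r, x = \pi_quot_ring r.
Proof. by exists (generic_quotient.repr x); rewrite reprK. Qed.

Lemma quot_mulA : associative quot_mul.
Proof.
move=> x y z; have [x' ->] := quot_piP x;
  have [y' ->] := quot_piP y; have [z' ->] := quot_piP z.
by rewrite !quot_piM mulrA.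
Qed.

Lemma quot_mulC : commutative quot_mul.
Proof.
move=> x y; have [x' ->] := quot_piP x; have [y' ->] := quot_piP y.
by rewrite !quot_piM mulrC.
Qed.

Lemma quot_mul1 : left_id quot_one quot_mul.
Proof. by move=> x; have [x' ->] := quot_piP x; rewrite quot_piM mul1r. Qed.

Lemma quot_mulDl : left_distributive quot_mul +%R.
Proof.
move=> x y z; have [x' ->] := quot_piP x;
  have [y' ->] := quot_piP y; have [z' ->] := quot_piP z.
by rewrite quot_piD !quot_piM quot_piD mulrDl.
Qed.

HB.instance Definition _ := GRing.Zmodule_isComPzRing.Build quot_ring
  quot_mulA quot_mulC quot_mul1 quot_mulDl.

End GeneratedIdeal.

(* Every ideal is generated by its own elements, so these are all the quotients
   of A by an ideal.                                                          *)
Definition quotient_of (A R : comPzRingType) : Prop :=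
  exists S : A -> Prop, ring_iso R (quot_ring S).

Section FiniteProduct.
Variables (n : nat) (A : 'I_n -> comPzRingType).

Definition prod_ring : Type := {dffun forall i : 'I_n, A i}.
HB.instance Definition _ := Choice.on prod_ring.

Implicit Types f g h : prod_ring.
Local Notation mk F := (finfun F : prod_ring).

Definition prod_zero : prod_ring := mk (fun i => 0 : A i).
Definition prod_one : prod_ring := mk (fun i => 1 : A i).
Definition prod_opp f : prod_ring := mk (fun i => - f i : A i).
Definition prod_add f g : prod_ring := mk (fun i => f i + g i : A i).
Definition prod_mul f g : prod_ring := mk (fun i => f i * g i : A i).

Lemma prod_addA : associative prod_add.
Proof. by move=> f g h; apply/ffunP=> i; rewrite !ffunE addrA. Qed.
Lemma prod_addC : commutative prod_add.
Proof. by move=> f g; apply/ffunP=> i; rewrite !ffunE addrC. Qed.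
Lemma prod_add0 : left_id prod_zero prod_add.
Proof. by move=> f; apply/ffunP=> i; rewrite !ffunE add0r. Qed.
Lemma prod_addN : left_inverse prod_zero prod_opp prod_add.
Proof. by move=> f; apply/ffunP=> i; rewrite !ffunE addNr. Qed.

HB.instance Definition _ := GRing.isZmodule.Build prod_ring
  prod_addA prod_addC prod_add0 prod_addN.

Lemma prod_mulA : associative prod_mul.
Proof. by move=> f g h; apply/ffunP=> i; rewrite !ffunE mulrA. Qed.
Lemma prod_mulC : commutative prod_mul.
Proof. by move=> f g; apply/ffunP=> i; rewrite !ffunE mulrC. Qed.
Lemma prod_mul1 : left_id prod_one prod_mul.
Proof. by move=> f; apply/ffunP=> i; rewrite !ffunE mul1r. Qed.
Lemma prod_mulDl : left_distributive prod_mul prod_add.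
Proof. by move=> f g h; apply/ffunP=> i; rewrite !ffunE mulrDl. Qed.

HB.instance Definition _ := GRing.Zmodule_isComPzRing.Build prod_ring
  prod_mulA prod_mulC prod_mul1 prod_mulDl.

End FiniteProduct.

Definition truncated_poly_F2 (l : nat) : comPzRingType :=
  quot_ring (fun y : {mpoly 'F_2[l]} => exists i : 'I_l, y = 'X_i ^+ 2).

(* The ideal P = (2, x_1 - 1, ..., x_l - 1) of Z_m[x_1, ..., x_l] (m > 1).   *)
Definition unit_point_ideal (m l : nat) : {mpoly 'Z_m[l]} -> Prop :=
  gen_ideal (fun y => y = 2%:R \/ exists i : 'I_l, y = 'X_i - 1).

Definition unit_point_quotient (m l : nat) : comPzRingType :=
  quot_ring (fun y : {mpoly 'Z_m[l]} =>
    exists r, unit_point_ideal r /\ y = r * (r + 2%:R)).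

(* A commutative k-algebra is a commutative ring R with a ring morphism
   iota : k -> R (comAlgType would exclude the zero algebra).                 *)
Definition finite_dimensional (k : fieldType) (R : comPzRingType)
    (iota : {rmorphism k -> R}) : Prop :=
  exists (n : nat) (e : 'I_n -> R),
    forall x : R, exists c : 'I_n -> k, x = \sum_(i < n) iota (c i) * e i.

Definition algebra_factor (A : comPzRingType) : Prop :=
  ring_iso A 'F_3 \/
  exists l, (0 < l)%N /\ quotient_of (truncated_poly_F2 l) A.

(* In the last two cases l = 0 is allowed and gives Z_4 and Z_8. *)
Definition finite_ring_factor (A : comPzRingType) : Prop :=
  [\/ exists l, (0 < l)%N /\ ring_iso A (truncated_poly_F2 l),
      ring_iso A 'F_3,
      exists l, ring_iso A (unit_point_quotient 4 l)
    | exists l, ring_iso A (unit_point_quotient 8 l)].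

Section GroupRing.
Variables (R : pzRingType) (gT : finGroupType).

Definition group_ring : Type := {ffun gT -> R}.
HB.instance Definition _ := GRing.Zmodule.on group_ring.

Implicit Types f g h : group_ring.

Definition group_ring_one : group_ring := [ffun x => (x == 1%g)%:R].
(* z = y^-1 * x is the unique z with y * z = x. *)
Definition group_ring_mul f g : group_ring :=
  [ffun x => \sum_(y : gT) f y * g (y^-1 * x)%g].

Lemma group_ring_mulA : associative group_ring_mul.
Proof.
move=> f g h; apply/ffunP=> x; rewrite !ffunE.
under eq_bigr => y _ do rewrite ffunE mulr_sumr.
under [RHS]eq_bigr => y _ do rewrite ffunE mulr_suml.
rewrite [RHS]exchange_big /=; apply: eq_bigr => y _.
rewrite [RHS](reindex_inj (mulgI y)) /=; apply: eq_bigr => z _.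
by rewrite mulKg invMg !mulgA mulrA.
Qed.

Lemma group_ring_mul1 : left_id group_ring_one group_ring_mul.
Proof.
move=> f; apply/ffunP=> x; rewrite !ffunE (bigD1 1%g) //= ffunE eqxx.
rewrite invg1 mul1g mul1r big1 ?addr0 // => y /negPf y1.
by rewrite ffunE y1 mul0r.
Qed.

Lemma group_ring_mulr1 : right_id group_ring_one group_ring_mul.
Proof.
move=> f; apply/ffunP=> x; rewrite !ffunE (bigD1 x) //= ffunE mulVg eqxx.
rewrite mulr1 big1 ?addr0 // => y yx.
by rewrite ffunE -eq_mulVg1 (negPf yx) mulr0.
Qed.

Lemma group_ring_mulDl : left_distributive group_ring_mul +%R.
Proof.
move=> f g h; apply/ffunP=> x; rewrite !ffunE -big_split /=.
by apply: eq_bigr => y _; rewrite ffunE mulrDl.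
Qed.

Lemma group_ring_mulDr : right_distributive group_ring_mul +%R.
Proof.
move=> f g h; apply/ffunP=> x; rewrite !ffunE -big_split /=.
by apply: eq_bigr => y _; rewrite ffunE mulrDr.
Qed.

HB.instance Definition _ := GRing.Zmodule_isPzRing.Build group_ring
  group_ring_mulA group_ring_mul1 group_ring_mulr1
  group_ring_mulDl group_ring_mulDr.

End GroupRing.

(* Finite quivers: loops and multiple arrows are allowed. *)
Record quiver := Quiver {
  vertex : finType;
  arrow : finType;
  source : arrow -> vertex;
  target : arrow -> vertex }.

Section Paths.
Variable Q : quiver.

Fixpoint is_walk (v : vertex Q) (s : seq (arrow Q)) : bool :=
  if s is a :: s' then (source a == v) && is_walk (target a) s' else true.

(* A directed path is a starting vertex with the sequence of arrows traversed
   from there, in the order of traversal; (i, [::]) is the path e_i.          *)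
Definition qpath : Type := {p : vertex Q * seq (arrow Q) | is_walk p.1 p.2}.
HB.instance Definition _ := SubChoice.on qpath.

Implicit Types (v : vertex Q) (a b c p : qpath).

Definition path_start p : vertex Q := (val p).1.
Definition path_arrows p : seq (arrow Q) := (val p).2.
Definition walk_end v (s : seq (arrow Q)) : vertex Q := last v (map (@target Q) s).
Definition path_end p : vertex Q := walk_end (path_start p) (path_arrows p).
Definition path_length p : nat := size (path_arrows p).
Definition trivial_path v : qpath := exist _ (v, [::]) (erefl true).

(* The product a b is b followed by a; None stands for 0. The insub below is
   never None (path_compE). *)
Definition path_comp a b : option qpath :=
  if path_end b == path_start a
  then insub (path_start b, path_arrows b ++ path_arrows a) : option qpath
  else None.

Lemma is_walk_cat v s t :
  is_walk v (s ++ t) = is_walk v s && is_walk (walk_end v s) t.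
Proof. by elim: s v => //= e s IHs v; rewrite IHs andbA. Qed.

Lemma walk_end_cat v s t : walk_end v (s ++ t) = walk_end (walk_end v s) t.
Proof. by rewrite /walk_end map_cat last_cat. Qed.

Lemma path_compE a b : path_end b = path_start a ->
  exists2 c, path_comp a b = Some c &
    val c = (path_start b, path_arrows b ++ path_arrows a).
Proof.
move=> eq_ab; rewrite /path_comp eq_ab eqxx.
case: insubP => [c _ <-|]; first by exists c.
by rewrite /= is_walk_cat (valP b) -/(path_end b) eq_ab (valP a).
Qed.

Lemma path_comp_neq a b : path_end b != path_start a -> path_comp a b = None.
Proof. by rewrite /path_comp => /negPf->. Qed.

Lemma path_compA a b c :
  obind (path_comp a) (path_comp b c) = obind (path_comp^~ c) (path_comp a b).
Proof.
have [cb|ncb] := eqVneq (path_end c) (path_start b); last first.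
  rewrite path_comp_neq //=.
  have [ba|nba] := eqVneq (path_end b) (path_start a); last by rewrite path_comp_neq.
  have [d -> dE] := path_compE ba.
  by rewrite /= path_comp_neq // /path_start dE.
have [d -> dE] := path_compE cb; rewrite /=.
have de : path_end d = path_end b.
  by rewrite /path_end /path_start /path_arrows dE walk_end_cat -/(path_end c) cb.
have [ba|nba] := eqVneq (path_end b) (path_start a); last first.
  by rewrite !path_comp_neq ?de.
have [e -> eE] := path_compE ba; rewrite /=.
have [f -> fE] : exists2 f, path_comp a d = Some f &
    val f = (path_start d, path_arrows d ++ path_arrows a).
  by apply: path_compE; rewrite de.
have [g -> gE] : exists2 g, path_comp e c = Some g &
    val g = (path_start c, path_arrows c ++ path_arrows e).
  by apply: path_compE; rewrite cb /path_start eE.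
congr Some; apply: val_inj; rewrite fE gE.
by rewrite /path_start /path_arrows dE eE /= catA.
Qed.

Lemma path_comp1 a v :
  path_comp (trivial_path v) a = if path_end a == v then Some a else None.
Proof.
rewrite /path_comp /=; case: eqP => // _.
by rewrite [path_arrows (trivial_path _)]/= cats0 -surjective_pairing valK.
Qed.

Lemma path_compr1 a v :
  path_comp a (trivial_path v) = if path_start a == v then Some a else None.
Proof.
rewrite /path_comp -[path_end _]/v eq_sym; case: eqP => //= <-.
by rewrite -[path_start (trivial_path _)]/(path_start a) -surjective_pairing valK.
Qed.

End Paths.

Definition acyclic (Q : quiver) : Prop :=
  forall p : qpath Q, (0 < path_length p)%N -> path_end p <> path_start p.

Definition trivial_quiver (Q : quiver) : Prop := #|arrow Q| = 0%N.

Section PathModule.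
Import monalg.
Variables (k : fieldType) (Q : quiver).

(* Finitely supported functions from paths to k, i.e. the free k-module on the
   paths (monalg gives no product here: paths do not form a monoid).          *)
Definition path_algebra : Type := {malg k[qpath Q]}.
HB.instance Definition _ := GRing.Lmodule.on path_algebra.

End PathModule.

(* The scalar multiple x p of the basis element p; locked because unification
   of two such terms is costly.                                               *)
HB.lock Definition path_monomial (k : fieldType) (Q : quiver) (x : k)
    (p : qpath Q) : path_algebra k Q :=
  monalg.mkmalgU p x.

Definition path_term (k : fieldType) (Q : quiver) (x : k)
    (o : option (qpath Q)) : path_algebra k Q :=
  if o is Some p then path_monomial x p else 0.

Definition path_algebra_one (k : fieldType) (Q : quiver) : path_algebra k Q :=
  \sum_(i : vertex Q) path_monomial 1 (trivial_path i).

(* The bilinear extension of path_comp. *)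
HB.lock Definition path_algebra_mul (k : fieldType) (Q : quiver)
    (f g : path_algebra k Q) : path_algebra k Q :=
  \sum_(p <- monalg.msupp f) \sum_(q <- monalg.msupp g)
    path_term (monalg.mcoeff p f * monalg.mcoeff q g) (path_comp p q).

Section PathAlgebra.
Import monalg.
Variables (k : fieldType) (Q : quiver).
Local Notation path_algebra := (path_algebra k Q).

Implicit Types (f g h : path_algebra) (p q : qpath Q) (x y : k).

Local Notation mulp := (@path_algebra_mul k Q).

Lemma path_term0 (o : option (qpath Q)) : path_term (0 : k) o = 0.
Proof. by case: o => //= p; rewrite unlock; apply: monalgU0. Qed.

Lemma path_termD x y (o : option (qpath Q)) : path_term (x + y) o = path_term x o + path_term y o.
Proof. by case: o => [p|] /=; [rewrite unlock; apply: monalgUD | rewrite addr0]. Qed.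

Lemma path_mulw (d1 d2 : {fset qpath Q}) f g :
  (msupp f `<=` d1)%fset -> (msupp g `<=` d2)%fset ->
  mulp f g = \sum_(p <- d1) \sum_(q <- d2) path_term (mcoeff p f * mcoeff q g) (path_comp p q).
Proof.
move=> le1 le2; rewrite [path_algebra_mul]unlock (big_fset_incl _ le1) /=.
  apply/eq_bigr=> p _; apply/big_fset_incl => // q _ /mcoeff_outdom ->.
  by rewrite mulr0 path_term0.
move=> p _ /mcoeff_outdom fp.
by rewrite big1 => // q _; rewrite fp mul0r path_term0.
Qed.

Lemma path_mulDl : left_distributive mulp +%R.
Proof.
move=> f g h; set d := (msupp f `|` msupp g)%fset; set e := msupp h.
rewrite (@path_mulw d e f) ?fsubsetUl // (@path_mulw d e g) ?fsubsetUr //.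
rewrite (@path_mulw d e) ?msuppD_le // -big_split; apply/eq_bigr => p _.
rewrite -big_split; apply/eq_bigr => q _.
by rewrite mcoeffD mulrDl path_termD.
Qed.

Lemma path_mulDr : right_distributive mulp +%R.
Proof.
move=> h f g; set d := (msupp f `|` msupp g)%fset; set e := msupp h.
rewrite (@path_mulw e d h f) ?fsubsetUl // (@path_mulw e d h g) ?fsubsetUr //.
rewrite (@path_mulw e d) ?msuppD_le // -big_split; apply/eq_bigr => p _.
rewrite -big_split; apply/eq_bigr => q _.
by rewrite mcoeffD mulrDr path_termD.
Qed.

Lemma path_mul0 : left_zero 0 mulp.
Proof. by move=> f; rewrite unlock msupp0 big_seq_fset0. Qed.

Lemma path_mulr0 : right_zero 0 mulp.
Proof.
by move=> f; rewrite unlock; apply: big1 => p _; rewrite msupp0 big_seq_fset0.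
Qed.

Lemma path_mul_suml (I : Type) (r : seq I) (P : pred I) (F : I -> path_algebra) g :
  mulp (\sum_(i <- r | P i) F i) g = \sum_(i <- r | P i) mulp (F i) g.
Proof. exact: (big_morph (mulp^~ g) (fun _ _ => path_mulDl _ _ _) (path_mul0 _)). Qed.

Lemma path_mul_sumr (I : Type) (r : seq I) (P : pred I) (F : I -> path_algebra) g :
  mulp g (\sum_(i <- r | P i) F i) = \sum_(i <- r | P i) mulp g (F i).
Proof. exact: (big_morph (mulp g) (fun _ _ => path_mulDr _ _ _) (path_mulr0 _)). Qed.

Lemma path_mulUU x y p q :
  mulp (path_monomial x p) (path_monomial y q) = path_term (x * y) (path_comp p q).
Proof.
rewrite [path_monomial]unlock (path_mulw msuppU_le msuppU_le).
by rewrite !big_seq_fset1 !mcoeffUU.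
Qed.

Lemma path_mul_termr x y p o :
  mulp (path_monomial x p) (path_term y o) = path_term (x * y) (obind (path_comp p) o).
Proof. by case: o => [q|]; [apply: path_mulUU | apply: path_mulr0]. Qed.

Lemma path_mul_terml x y p o :
  mulp (path_term x o) (path_monomial y p) =
  path_term (x * y) (obind ((@path_comp Q)^~ p) o).
Proof. by case: o => [q|]; [apply: path_mulUU | apply: path_mul0]. Qed.

Lemma path_algebra_ind (P : path_algebra -> Prop) :
  P 0 -> (forall f g, P f -> P g -> P (f + g)) -> (forall x p, P (path_monomial x p)) ->
  forall f, P f.
Proof.
move=> P0 PD PU f; rewrite (monalgE f).
by apply: (big_ind P) => // p _; have := PU (mcoeff p f) p; rewrite unlock.
Qed.

Lemma path_mulA : associative mulp.
Proof.
move=> f g h; elim/path_algebra_ind: f => [|f1 f2 IH1 IH2|x p].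
- by rewrite !path_mul0.
- by rewrite !path_mulDl IH1 IH2.
elim/path_algebra_ind: g => [|g1 g2 IH1 IH2|y q].
- by rewrite path_mul0 path_mulr0 path_mul0.
- by rewrite path_mulDl !path_mulDr path_mulDl IH1 IH2.
elim/path_algebra_ind: h => [|h1 h2 IH1 IH2|z r].
- by rewrite !path_mulr0.
- by rewrite !path_mulDr IH1 IH2.
by rewrite !path_mulUU path_mul_termr path_mul_terml mulrA path_compA.
Qed.

Lemma path_mul1 : left_id (path_algebra_one k Q) mulp.
Proof.
elim/path_algebra_ind=> [|f g IHf IHg|x p]; first exact: path_mulr0.
  by rewrite path_mulDr IHf IHg.
rewrite path_mul_suml (bigD1 (path_end p)) //= path_mulUU path_comp1 eqxx mul1r.
rewrite big1 /= ?addr0 // => v /negPf nv.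
by rewrite path_mulUU path_comp1 eq_sym nv.
Qed.

Lemma path_mulr1 : right_id (path_algebra_one k Q) mulp.
Proof.
elim/path_algebra_ind=> [|f g IHf IHg|x p]; first exact: path_mul0.
  by rewrite path_mulDl IHf IHg.
rewrite path_mul_sumr (bigD1 (path_start p)) //= path_mulUU path_compr1 eqxx mulr1.
rewrite big1 /= ?addr0 // => v /negPf nv.
by rewrite path_mulUU path_compr1 eq_sym nv.
Qed.

HB.instance Definition _ := GRing.Zmodule_isPzRing.Build path_algebra
  path_mulA path_mul1 path_mulr1 path_mulDl path_mulDr.

End PathAlgebra.

(* Main.v *)
(* The identity x^6 = x^4 forces u^2 = 1 on units and passes to products and
   quotients. It holds in F_3, in F_2[x]/(x_i^2) (where squares are 0 or 1) and
   in Z_4[x]/(r(r+2)), Z_8[x]/(r(r+2)): there every element is r or 1 + r with r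
   in P, and r(r+2) = 0 gives r^4 = -8r = 0 and (1+r)^2 = 1.

   Conversely, a finite commutative ring is the product of its quotients by
   1 - e, e ranging over primitive idempotents. In such a factor some power of
   each x is 0 or 1, so x is nilpotent or x^2 = 1; and x(x+2) = (1+x)^2 - 1 = 0
   for x nilpotent. If 2 is a unit, nilpotents vanish and the factor is F_3;
   otherwise 2 is nilpotent, so 8 = 2(2+2) = 0, and sending variables to all
   units presents the factor as a quotient of Z_8[x]/(r(r+2)).

   For Z_n G, the scalars give n | 24 and the group elements give exponent 2.
   The units 18 + g and 1 + 9(g + h), of order 4, exclude n = 8, 24 and
   |G| > 2 for n = 4, 12. For n | 6, the maps 3x^2 and 2x^3 are additive and
   yield x^4 = x^2. For kQ, an arrow p gives the unit 1 + p of square 1 + 2p,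
   and composable arrows p, q give 1 + p + q, whose square is 1 + qp when 2 = 0. *)

Require Import Defs.
From HB Require Import structures.
From mathcomp Require Import all_boot all_order all_fingroup all_algebra all_solvable.
From mathcomp Require Import finmap boolp mpoly ring.
From mathcomp Require monalg.

Set Implicit Arguments.
Unset Strict Implicit.
Unset Printing Implicit Defensive.

Import GRing.Theory.
Local Open Scope ring_scope.
Local Open Scope quotient_scope.

(** * Quotients and finite products *)

Lemma ring_iso_sym (R S : pzRingType) : ring_iso R S -> ring_iso S R.
Proof.
move=> [f [g fK gK]].
have gB : GRing.zmod_morphism g by move=> x y; apply: (canLR fK); rewrite rmorphB !gK.
have gM : GRing.monoid_morphism g.
  split=> [|x y]; first by apply: (canLR fK); rewrite rmorph1.
  by apply: (canLR fK); rewrite rmorphM !gK.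
pose g' : {rmorphism S -> R} :=
  HB.pack g (GRing.isZmodMorphism.Build S R g gB) (GRing.isMonoidMorphism.Build S R g gM).
by exists g', f.
Qed.

Lemma ring_iso_inj_surj (R S : pzRingType) (f : {rmorphism R -> S}) :
  (forall x, f x = 0 -> x = 0) -> (forall y, exists x, f x = y) -> ring_iso R S.
Proof.
move=> f0 /choice[g gK]; exists f; exists g => // x.
by apply/eqP; rewrite -subr_eq0; apply/eqP/f0; rewrite rmorphB gK subrr.
Qed.

Section QuotRing.
Variables (R : comPzRingType) (S : R -> Prop).

(** A named copy of the projection, so that it can carry a ring morphism structure. *)
Definition quot_pi (x : R) : quot_ring S := \pi_(quot_ring S) x.

Lemma quot_pi_zmod : GRing.zmod_morphism quot_pi.
Proof.
move=> x y; apply: (canRL (addrK _)); rewrite /quot_pi.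
by rewrite [LHS]quot_piD subrK.
Qed.

Lemma quot_pi_monoid : GRing.monoid_morphism quot_pi.
Proof. by split=> // x y; rewrite -[LHS]quot_piM. Qed.

HB.instance Definition _ :=
  GRing.isZmodMorphism.Build R (quot_ring S) quot_pi quot_pi_zmod.
HB.instance Definition _ :=
  GRing.isMonoidMorphism.Build R (quot_ring S) quot_pi quot_pi_monoid.

Lemma quot_pi_surj (y : quot_ring S) : exists x, quot_pi x = y.
Proof. by have [x ->] := quot_piP y; exists x. Qed.

Lemma quot_pi_eq0 x : quot_pi x = 0 <-> gen_ideal S x.
Proof.
rewrite -[X in _ = X](rmorph0 quot_pi) -[x in gen_ideal S x]subr0.
by split=> [/eqP|/gen_idealP Sx]; [|apply/eqP]; rewrite /quot_pi -Quotient.idealrBE // => /gen_idealP.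
Qed.

Lemma gen_ideal_gen x : S x -> gen_ideal S x.
Proof.
by move=> Sx; exists 1%N, (fun=> 1), (fun=> x); split=> //; rewrite big_ord1 mul1r.
Qed.

Lemma gen_idealD x y : gen_ideal S x -> gen_ideal S y -> gen_ideal S (x + y).
Proof. by move=> Sx Sy; rewrite -[x]mul1r; apply: gen_idealMD. Qed.

Lemma gen_idealM a x : gen_ideal S x -> gen_ideal S (a * x).
Proof. by move=> Sx; rewrite -[a * x]addr0; apply/gen_idealMD/gen_ideal0. Qed.

Lemma gen_ideal_morph0 (A : pzRingType) (f : {rmorphism R -> A}) :
  (forall x, S x -> f x = 0) -> forall x, gen_ideal S x -> f x = 0.
Proof.
move=> fS x [n [a [s [Ss ->]]]]; rewrite rmorph_sum big1 // => i _.
by rewrite rmorphM (fS _ (Ss i)) mulr0.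
Qed.

Lemma quot_lift (A : pzRingType) (f : {rmorphism R -> A}) :
    (forall x, S x -> f x = 0) ->
  exists g : {rmorphism quot_ring S -> A}, forall x, g (quot_pi x) = f x.
Proof.
(* The value at a representative is independent of its choice because [f] vanishes on the ideal. *)
move=> fS; pose g (y : quot_ring S) := f (generic_quotient.repr y).
have gE x : g (quot_pi x) = f x.
  rewrite /g; apply/eqP; rewrite -subr_eq0 -rmorphB; apply/eqP.
  apply: (gen_ideal_morph0 fS); apply/quot_pi_eq0; rewrite rmorphB /=.
  by rewrite {1}/quot_pi reprK subrr.
have gB : GRing.zmod_morphism g.
  move=> x y; have [x' <-] := quot_pi_surj x; have [y' <-] := quot_pi_surj y.
  by rewrite -rmorphB !gE rmorphB.
have gM : GRing.monoid_morphism g.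
  split=> [|x y]; first by rewrite -(rmorph1 quot_pi) gE rmorph1.
  have [x' <-] := quot_pi_surj x; have [y' <-] := quot_pi_surj y.
  by rewrite -rmorphM !gE rmorphM.
pose g' : {rmorphism quot_ring S -> A} :=
  HB.pack g (GRing.isZmodMorphism.Build _ _ g gB) (GRing.isMonoidMorphism.Build _ _ g gM).
by exists g'.
Qed.

End QuotRing.

Lemma quotient_of_surj (A R : comPzRingType) :
  quotient_of A R <-> exists f : {rmorphism A -> R}, forall y, exists x, f x = y.
Proof.
split=> [[S /ring_iso_sym[f [g _ gK]]] | [f f_surj]].
  exists (f \o @quot_pi A S : {rmorphism A -> R}) => y.
  by have [x xE] := quot_pi_surj (g y); exists x; rewrite /= xE gK.
(* First isomorphism theorem, with the whole kernel of [f] as generating set. *)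
have [|g gE] := @quot_lift A (fun x => f x = 0) _ f; first by [].
exists (fun x => f x = 0); apply: ring_iso_sym; apply: (@ring_iso_inj_surj _ _ g).
  by move=> y; have [x <-] := quot_pi_surj y; rewrite gE => fx0; apply/quot_pi_eq0/gen_ideal_gen.
by move=> y; have [x <-] := f_surj y; exists (quot_pi _ x); rewrite gE.
Qed.

Section ProductRing.
Variables (n : nat) (A : 'I_n -> comPzRingType).

Definition prod_proj i (x : prod_ring A) : A i := x i.

Lemma prod_proj_zmod i : GRing.zmod_morphism (@prod_proj i).
Proof. by move=> x y; rewrite /prod_proj !ffunE. Qed.

Lemma prod_proj_monoid i : GRing.monoid_morphism (@prod_proj i).
Proof. by split=> [|x y]; rewrite /prod_proj !ffunE. Qed.

HB.instance Definition _ i :=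
  GRing.isZmodMorphism.Build (prod_ring A) (A i) (@prod_proj i) (@prod_proj_zmod i).
HB.instance Definition _ i :=
  GRing.isMonoidMorphism.Build (prod_ring A) (A i) (@prod_proj i) (@prod_proj_monoid i).

Lemma prod_ringP (x y : prod_ring A) : (forall i, prod_proj i x = prod_proj i y) -> x = y.
Proof. by move=> eq_xy; apply/ffunP=> i; apply: eq_xy. Qed.

Lemma prod_ring_ex (x : forall i, A i) : exists y, forall i, prod_proj i y = x i.
Proof. by exists (finfun x) => i; rewrite /prod_proj ffunE. Qed.

Lemma prod_ring_morph (R : pzRingType) (f : forall i, {rmorphism R -> A i}) :
  exists F : {rmorphism R -> prod_ring A}, forall i x, prod_proj i (F x) = f i x.
Proof.
have /choice[F FE] (x : R) := prod_ring_ex (fun i => f i x).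
have FB : GRing.zmod_morphism F.
  by move=> x y; apply: prod_ringP => i; rewrite rmorphB /= !FE rmorphB.
have FM : GRing.monoid_morphism F.
  split=> [|x y]; apply: prod_ringP => i; first by rewrite FE !rmorph1.
  by rewrite rmorphM /= !FE rmorphM.
pose F' : {rmorphism R -> prod_ring A} :=
  HB.pack F (GRing.isZmodMorphism.Build _ _ F FB) (GRing.isMonoidMorphism.Build _ _ F FM).
by exists F' => i x; apply: FE.
Qed.

End ProductRing.

Lemma quotient_of_prod n (A B : 'I_n -> comPzRingType) :
  (forall i, quotient_of (A i) (B i)) -> quotient_of (prod_ring A) (prod_ring B).
Proof.
move=> qAB; have /fin_all_exists[f f_surj] i := (quotient_of_surj (A i) (B i)).1 (qAB i).
pose fp i : {rmorphism prod_ring A -> B i} := f i \o @prod_proj n A i.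
apply/quotient_of_surj; have [F FE] := prod_ring_morph fp; exists F => y.
have /fin_all_exists[x xE] i := f_surj i (y i); have [x' x'E] := prod_ring_ex x.
by exists x'; apply: prod_ringP => i; rewrite FE /= x'E xE.
Qed.

(** The ideal generated by 1 - e is the annihilator of e: if x e = 0, then x = x (1 - e). *)
Lemma quot_idem_eq0 (R : comPzRingType) (e x : R) : e * e = e ->
  quot_pi (fun y => y = 1 - e) x = 0 <-> x * e = 0.
Proof.
move=> ee; rewrite quot_pi_eq0; split=> [[m [a [s [Ss ->]]]] | xe0].
  by rewrite mulr_suml big1 // => j _; rewrite Ss -mulrA mulrBl mul1r ee subrr mulr0.
by rewrite -[x]subr0 -xe0 -{1}[x]mulr1 -mulrBr; apply/gen_idealM/gen_ideal_gen.
Qed.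

Lemma quot_idem1 (R : comPzRingType) (e : R) : quot_pi (fun y => y = 1 - e) e = 1.
Proof.
apply/eqP; rewrite eq_sym -subr_eq0 -(rmorph1 (quot_pi _)) -rmorphB; apply/eqP.
exact/quot_pi_eq0/gen_ideal_gen.
Qed.

(* [R / (1 - e i)] plays the role of the corner ring [e i R]. *)
Lemma prod_idempotents (R : comPzRingType) n (e : 'I_n -> R) :
    (forall i, e i * e i = e i) -> (forall i j, i != j -> e i * e j = 0) ->
    \sum_(i < n) e i = 1 ->
  ring_iso R (prod_ring (fun i => quot_ring (fun y => y = 1 - e i))).
Proof.
move=> e_id e_orth e1; set A := fun i => _.
pose p i : {rmorphism R -> A i} := quot_pi (fun y => y = 1 - e i).
have pe i : p i (e i) = 1 := quot_idem1 (e i).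
have [F FE] := prod_ring_morph p.
apply: (@ring_iso_inj_surj _ _ F) => [x Fx0 | y].
  rewrite -[x]mulr1 -e1 mulr_sumr big1 // => i _.
  by apply/(quot_idem_eq0 _ (e_id i)); rewrite -[LHS]FE Fx0 rmorph0.
have /fin_all_exists[x xE] i : exists x, p i x = prod_proj i y := quot_pi_surj (y i).
(* Each lift [x i] is weighted by [e i], which maps to 1 in its own factor and to 0 in the
   others. *)
exists (\sum_i x i * e i); apply: prod_ringP => j; rewrite FE rmorph_sum (bigD1 j) //=.
rewrite rmorphM pe mulr1 xE big1 ?addr0 // => i ij.
by rewrite -[LHS]mulr1 -(pe j) -!rmorphM -mulrA e_orth // mulr0 rmorph0.
Qed.

Section OrdCast.
Variables (q : nat) (A : pzRingType).
Hypothesis qA0 : q.+2%:R = 0 :> A.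

(** Stated over ['I_q.+2], to which ['F_2], ['F_3] and ['Z_8] all compute, so that one map serves
    the three rings. *)
Definition ord_cast (x : 'I_q.+2) : A := (x : nat)%:R.

Lemma natr_modn m : (m %% q.+2)%:R = m%:R :> A.
Proof. by rewrite {2}(divn_eq m q.+2) natrD natrM qA0 mulr0 add0r. Qed.

Lemma ord_cast_zmod : GRing.zmod_morphism ord_cast.
Proof.
move=> x y; apply: (canRL (addrK _)); rewrite /ord_cast -natrD -natr_modn.
by rewrite -[(_ %% _)%N]/(nat_of_ord (x - y + y)) subrK.
Qed.

Lemma ord_cast_monoid : GRing.monoid_morphism ord_cast.
Proof.
by split=> [|x y] //; rewrite /ord_cast -natrM -[RHS]natr_modn.
Qed.

Lemma ord_cast_morph : exists f : {rmorphism 'I_q.+2 -> A}, f =1 ord_cast.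
Proof.
pose f : {rmorphism 'I_q.+2 -> A} :=
  HB.pack ord_cast (GRing.isZmodMorphism.Build _ _ ord_cast ord_cast_zmod)
    (GRing.isMonoidMorphism.Build _ _ ord_cast ord_cast_monoid).
by exists f.
Qed.

End OrdCast.

(** * The identity x^6 = x^4 *)

Definition exp6_eq4 (R : pzRingType) := forall x : R, x ^+ 6 = x ^+ 4.

(** For a unit u, the invertible factor u^4 cancels from u^6 = u^4. *)
Lemma exp6_eq4_Delta (R : pzRingType) : exp6_eq4 R -> Delta_ring 2 R.
Proof.
move=> R64 u [v [uv vu]].
have uv4 : u ^+ 4 * v ^+ 4 = 1 by rewrite -exprMn_comm ?uv ?expr1n // /GRing.comm uv.
by rewrite -[u ^+ 2]mulr1 -uv4 mulrA -exprD R64.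
Qed.

Lemma exp6_eq4_surj (R S : pzRingType) (f : {rmorphism R -> S}) :
  (forall y, exists x, f x = y) -> exp6_eq4 R -> exp6_eq4 S.
Proof. by move=> f_surj R64 y; have [x <-] := f_surj y; rewrite -!rmorphXn R64. Qed.

Lemma exp6_eq4_iso (R S : pzRingType) : ring_iso R S -> exp6_eq4 R -> exp6_eq4 S.
Proof. by move=> [f [g _ gK]]; apply: (@exp6_eq4_surj _ _ f) => y; exists (g y). Qed.

Lemma exp6_eq4_quotient (A R : comPzRingType) :
  quotient_of A R -> exp6_eq4 A -> exp6_eq4 R.
Proof. by move=> /quotient_of_surj[f f_surj]; apply: exp6_eq4_surj. Qed.

Lemma exp6_eq4_prod n (A : 'I_n -> comPzRingType) :
  (forall i, exp6_eq4 (A i)) -> exp6_eq4 (prod_ring A).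
Proof. by move=> A64 x; apply: prod_ringP => i; rewrite !rmorphXn A64. Qed.

Lemma exp6_eq4_F3 : exp6_eq4 'F_3.
Proof. by move=> x; apply/eqP; case: x; do 3?[case=> //]. Qed.

Lemma mpoly_ring_ind (R : comNzRingType) n (P : {mpoly R[n]} -> Prop) :
    (forall c, P c%:MP) -> (forall i, P 'X_i) ->
    (forall p q, P p -> P q -> P (p + q)) -> (forall p q, P p -> P q -> P (p * q)) ->
  forall p, P p.
Proof.
move=> PC PX PD PM p; rewrite (mpolyE p); apply: big_ind => // [|m _].
  by rewrite -mpolyC0.
rewrite -mul_mpolyC; apply: (PM) => //; rewrite mpolyXE_id; have P1 : P 1 by rewrite -mpolyC1.
apply: (big_ind P) => [||i _]; [exact: P1|exact: PM|].
by elim: (m i : nat) => [|k IHk]; rewrite ?expr0 ?exprS //; apply: PM.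
Qed.

(** The universal property of polynomial rings; [1 != 0] allows [A] to be repacked as a
    [comNzRingType], the target that [mmap] takes. *)
Lemma mpoly_eval (R : comNzRingType) (A : comPzRingType) n (f : {rmorphism R -> A})
    (h : 'I_n -> A) : 1 != 0 :> A ->
  exists F : {rmorphism {mpoly R[n]} -> A},
    (forall c, F c%:MP = f c) /\ (forall i, F 'X_i = h i).
Proof.
move=> A1; pose A' : comNzRingType := HB.pack A (GRing.PzSemiRing_isNonZero.Build A A1).
pose f' : {rmorphism R -> A'} := f; exists (mmap f' h : {rmorphism {mpoly R[n]} -> A'}).
by split=> [c|i]; [apply: (mmapC (S := A')) | rewrite /= (mmapX (S := A')) (mmap1U (S := A'))].
Qed.

Lemma natr_quot_mpoly0 (R : comNzRingType) n (S : {mpoly R[n]} -> Prop) k :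
  k%:R = 0 :> R -> k%:R = 0 :> quot_ring S.
Proof.
by move=> k0; rewrite -(rmorph_nat (quot_pi S)) -(rmorph_nat (@mpolyC n R)) k0 !rmorph0.
Qed.

(** Since 2 = 0, squaring is additive as well as multiplicative, so the elements with square 0 or 1
    are closed under sums and products; constants and variables are among them. *)
Lemma exp6_eq4_truncated l : exp6_eq4 (truncated_poly_F2 l).
Proof.
move=> x; have [p <-] := quot_pi_surj x; pose pi : {rmorphism _ -> truncated_poly_F2 l} := quot_pi _.
rewrite -[quot_pi _ p]/(pi p).
have two0 : 2%:R = 0 :> truncated_poly_F2 l by apply/natr_quot_mpoly0/val_inj.
suffices [p0|p1] : pi p ^+ 2 = 0 \/ pi p ^+ 2 = 1.
- by rewrite -[6%N]/(2 * 3)%N -[4%N]/(2 * 2)%N !exprM p0 !expr0n.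
- by rewrite -[6%N]/(2 * 3)%N -[4%N]/(2 * 2)%N !exprM p1 !expr1n.
elim/mpoly_ring_ind: p => [c|i|p q IHp IHq|p q IHp IHq].
- have [->|->] : c = 0 \/ c = 1 by case: c; do 2?[case=> //]; [left | right]; apply: val_inj.
  + by left; rewrite mpolyC0 rmorph0 expr0n.
  + by right; rewrite mpolyC1 rmorph1 expr1n.
- by left; rewrite -rmorphXn; apply/quot_pi_eq0/gen_ideal_gen; exists i.
- rewrite rmorphD sqrrD -mulr_natr two0 mulr0 addr0.
  case: IHp => ->; case: IHq => ->; rewrite ?add0r ?addr0; auto.
- by rewrite rmorphM exprMn; case: IHp => ->; case: IHq => ->; rewrite ?mul0r ?mulr0 ?mulr1; auto.
Qed.

(** Modulo P, 2 vanishes and every variable becomes 1, so 0 and 1 represent all cosets. *)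
Lemma unit_point_ideal01 m l (p : {mpoly 'Z_m[l]}) : (1 < m)%N ->
  unit_point_ideal p \/ unit_point_ideal (p - 1).
Proof.
move=> m1; have gen2 (a : {mpoly 'Z_m[l]}) : unit_point_ideal (a * 2%:R).
  by apply/gen_idealM/gen_ideal_gen; left.
elim/mpoly_ring_ind: p => [c|i|p q IHp IHq|p q IHp IHq].
- rewrite -(natr_Zp c) rmorph_nat -(odd_double_half c) -muln2 natrD natrM.
  by case: odd; [right; rewrite addrAC subrr add0r | left; rewrite add0r]; apply: gen2.
- by right; apply: gen_ideal_gen; right; exists i.
- case: IHp => Pp; case: IHq => Pq.
  + by left; apply: gen_idealD.
  + by right; rewrite -addrA; apply: gen_idealD.
  + by right; rewrite addrAC; apply: gen_idealD.
  + left; rewrite (_ : p + q = (p - 1) + (q - 1) + 1 * 2%:R); last by ring.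
    by apply: gen_idealD; [apply: gen_idealD|apply: gen2].
- case: IHp => Pp; case: IHq => Pq.
  + by left; rewrite mulrC; apply: gen_idealM.
  + by left; rewrite mulrC; apply: gen_idealM.
  + by left; apply: gen_idealM.
  + right; rewrite (_ : p * q - 1 = q * (p - 1) + (q - 1)); last by ring.
    by apply: gen_idealD => //; apply: gen_idealM.
Qed.

Lemma exp6_eq4_unit_point m l : (1 < m)%N -> (m %| 8)%N -> exp6_eq4 (unit_point_quotient m l).
Proof.
move=> m1 m8 x; have [p <-] := quot_pi_surj x; pose pi : {rmorphism _ -> unit_point_quotient m l} := quot_pi _.
rewrite -[quot_pi _ p]/(pi p).
have eight0 : 8%:R = 0 :> unit_point_quotient m l.
  by apply: natr_quot_mpoly0; rewrite -Zp_nat_mod // (eqP m8).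
have piP r : unit_point_ideal r -> pi r * (pi r + 2%:R) = 0.
  move=> Pr; rewrite -(rmorph_nat pi) -rmorphD -rmorphM.
  by apply/quot_pi_eq0/gen_ideal_gen; exists r.
have [/piP r0|/piP r0] := unit_point_ideal01 p m1.
  set r := pi p in r0 *; suffices r4 : r ^+ 4 = 0 by rewrite -[6%N]/(4 + 2)%N exprD r4 mul0r.
  (* Sum of cubes: (r + 2)(r^2 - 2r + 4) = r^3 + 8. *)
  have -> : r ^+ 4 = r * (r + 2%:R) * (r ^+ 2 - 2%:R * r + 4%:R) - 8%:R * r by ring.
  by rewrite r0 eight0 !mul0r subrr.
(* With r = p - 1, the relation r (r + 2) = 0 reads p^2 - 1 = 0. *)
suffices p2 : pi p ^+ 2 = 1 by rewrite -[6%N]/(2 * 3)%N -[4%N]/(2 * 2)%N !exprM p2 !expr1n.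
by apply/eqP; rewrite -subr_eq0 -[X in _ == X]r0 rmorphB rmorph1; apply/eqP; ring.
Qed.

(** * Primitive idempotents of finite commutative rings *)

Definition primitive_idem (R : comPzRingType) (e : R) : Prop :=
  [/\ e * e = e, e != 0 & forall f, f * f = f -> f * e = f -> f = 0 \/ f = e].

Lemma count_ltn (T : eqType) (s : seq T) (a b : pred T) x :
  subpred a b -> x \in s -> b x -> ~~ a x -> (count a s < count b s)%N.
Proof.
move=> sub_ab xs bx ax.
have := count_predUI a (predD b a) s.
rewrite (@eq_count _ (predI _ _) pred0) ?count_pred0 ?addn0; last first.
  by move=> y /=; rewrite andbA andbN.
rewrite (@eq_count _ (predU _ _) b) => [->|y /=]; last first.
  by have := sub_ab y; case: (a y) => //= ->.
by rewrite -[ltnLHS]addn0 ltn_add2l -has_count; apply/hasP; exists x; rewrite //= ax.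
Qed.

(** Induction on the size of the corner ring eR, counted along [s] as the x with x e = x. A
    non-primitive e splits as f + (e - f) with orthogonal idempotents, and both corners are smaller
    since they miss e. The list [s], possibly with repetitions, expresses the finiteness of R. *)
Lemma idem_decomposition (R : comPzRingType) (s : seq R) : (forall x, x \in s) ->
  forall e : R, e * e = e -> exists t : seq R,
    [/\ \sum_(x <- t) x = e, forall x, x \in t -> primitive_idem x /\ x * e = x
      & pairwise (fun x y => x * y == 0) t].
Proof.
move=> sR e; have [N] := ubnP (count (fun x => x * e == x) s).
elim: N e => // N IHN e /ltnSE leN ee.
have [e0|e0] := eqVneq e 0; first by exists [::]; rewrite big_nil e0.
have [e_prim|] := EM (forall f, f * f = f -> f * e = f -> f = 0 \/ f = e).
  by exists [:: e]; rewrite big_seq1; split=> // x; rewrite inE => /eqP->.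
move=> /existsNP[f /not_implyP[ff /not_implyP[fe /not_orP[/eqP f0 /eqP nfe]]]].
have lt_count g : g * g = g -> g * e = g -> g != e ->
    (count (fun x => (x * g == x)%R) s < N)%N.
  move=> gg ge ne; apply: leq_trans leN; apply: (@count_ltn _ _ _ _ e) => //=; last first.
  - by rewrite mulrC ge.
  - by rewrite ee.
  by move=> x /eqP xg; rewrite -{1}xg -mulrA ge xg.
pose g := e - f.
have gg : g * g = g by rewrite /g mulrBl !mulrBr ee ff fe (mulrC e) fe subrr subr0.
have ge : g * e = g by rewrite /g mulrBl ee fe.
have fg : f * g = 0 by rewrite /g mulrBr fe ff subrr.
have ng : g != e by rewrite /g -subr_eq0 addrAC subrr sub0r oppr_eq0.
have [t [t_sum tP t_orth]] := IHN f (lt_count _ ff fe nfe) ff.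
have [u [u_sum uP u_orth]] := IHN g (lt_count _ gg ge ng) gg.
exists (t ++ u); split.
- by rewrite big_cat /= t_sum u_sum addrC subrK.
- move=> x; rewrite mem_cat => /orP[/tP[px xf] | /uP[px xg]]; split=> //.
    by rewrite -{1}xf -mulrA fe.
  by rewrite -{1}xg -mulrA ge.
rewrite pairwise_cat t_orth u_orth !andbT; apply/allrelP => x y /tP[_ xf] /uP[_ yg].
by rewrite -xf -yg mulrACA fg mulr0.
Qed.

Lemma primitive_decomposition (R : comPzRingType) (s : seq R) : (forall x, x \in s) ->
  exists (n : nat) (e : 'I_n -> R), (forall i, primitive_idem (e i)) /\
    ring_iso R (prod_ring (fun i => quot_ring (fun y => y = 1 - e i))).
Proof.
move=> sR; have [t [t_sum tP t_orth]] := idem_decomposition sR (mulr1 1).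
have e_prim (i : 'I_(size t)) : primitive_idem (nth 0 t i).
  by have [] := tP _ (mem_nth 0 (ltn_ord i)).
exists (size t), (fun i => nth 0 t i); split=> //; apply: prod_idempotents.
- by move=> i; have [] := e_prim i.
- move=> i j; wlog ltij : i j / (i < j)%N => [IH|_].
    by case: (ltngtP i j) => [/IH|/IH H|/val_inj->]; rewrite ?eqxx // mulrC eq_sym.
  by apply/eqP; move/pairwiseP: t_orth => ->; rewrite ?inE.
by rewrite -t_sum [RHS](big_nth 0) big_mkord.
Qed.

(** Units lift: if r is invertible modulo 1 - e, then r e + (1 - e) is a unit of R with the same
    image as r. *)
Lemma Delta_idem_quot (R : comPzRingType) (e : R) p : e * e = e ->
  Delta_ring p R -> Delta_ring p (quot_ring (fun y => y = 1 - e)).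
Proof.
move=> ee RD u [v [uv _]]; have [r rE] := quot_pi_surj u; have [s sE] := quot_pi_surj v.
have rse : r * s * e = e.
  apply/eqP; rewrite -subr_eq0 -{2}[e]mul1r -mulrBl; apply/eqP.
  by apply/quot_idem_eq0; rewrite // rmorphB rmorphM rmorph1 /= rE sE uv subrr.
pose lift x := x * e + (1 - e).
have liftE x : quot_pi (fun y => y = 1 - e) (lift x) = quot_pi _ x.
  by rewrite /lift rmorphD rmorphM rmorphB rmorph1 /= quot_idem1 mulr1 subrr addr0.
have lift1 : lift r * lift s = 1.
  rewrite /lift (_ : _ * _ = r * s * (e * e) + (r + s) * (e - e * e) + 1 - 2%:R * e + e * e).
    by rewrite ee rse subrr mulr0; ring.
  ring.
rewrite -rE -liftE -rmorphXn RD ?rmorph1 //; exists (lift s); split=> //.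
by rewrite mulrC.
Qed.

(** * Connected finite rings *)

Section Connected.
Variables (A : comPzRingType) (s : seq A).
Hypothesis sA : forall x, x \in s.
Hypothesis A1 : 1 != 0 :> A.
Hypothesis A_conn : forall f : A, f * f = f -> f = 0 \/ f = 1.

Lemma nilp_or_unit (x : A) : (exists n, x ^+ n = 0) \/ is_unit x.
Proof.
have [i [d xid]] : exists i d, x ^+ i = x ^+ (i + d.+1).
  (* Pigeonhole: one more power of x than [s] has entries forces a repetition. *)
  have /(uniqPn 0)[i [j [ltij]]] : ~~ uniq (mkseq (GRing.exp x) (size s).+1).
    by apply/negP => /uniq_leq_size/(_ (fun y _ => sA y)); rewrite size_mkseq ltnn.
  rewrite size_mkseq => ltj; rewrite !nth_mkseq ?(ltn_trans ltij) // => eq_ij.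
  by exists i, (j - i.+1)%N; rewrite addnS -addSn subnKC.
have per m k : (i <= m)%N -> x ^+ (m + k * d.+1) = x ^+ m.
  move=> im; elim: k => [|k IHk]; rewrite ?addn0 // mulSn -{1}(subnKC im) addnACA.
  by rewrite exprD -xid -exprD addnA subnKC.
(* A positive multiple of the period [d.+1] that is at least the preperiod [i], so that x^(2n) =
   x^n. *)
pose n := (i.+1 * d.+1)%N.
have xnn : x ^+ n * x ^+ n = x ^+ n.
  by rewrite -exprD per // /n mulnS mulSn; apply: leq_trans (leq_addr _ _).
have [xn0|xn1] := A_conn xnn; first by left; exists n.
by right; exists (x ^+ n.-1); rewrite -exprS -exprSr prednK.
Qed.

End Connected.

(** The inverse is the finite geometric series in -x. *)
Lemma nilp_unit1 (A : comPzRingType) (x : A) n : x ^+ n = 0 -> is_unit (1 + x).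
Proof.
move=> xn0; pose v := \sum_(i < n) (- x) ^+ i.
have uv : (1 + x) * v = 1.
  have := subrX1 (- x) n; rewrite exprNn xn0 mulr0 sub0r => /(congr1 -%R).
  by rewrite opprK -mulNr opprB opprK -/v => <-.
by exists v; rewrite [v * _]mulrC uv.
Qed.

Lemma Delta2_nilp (A : comPzRingType) (x : A) n :
  Delta_ring 2 A -> x ^+ n = 0 -> x * (x + 2%:R) = 0.
Proof.
move=> AD /nilp_unit1/AD x1.
rewrite (_ : x * (x + 2%:R) = (1 + x) ^+ 2 - 1); last by ring.
by rewrite x1 subrr.
Qed.

Lemma iso_F3 (A : pzRingType) : 1 != 0 :> A -> 3%:R = 0 :> A ->
  (forall x : A, [\/ x = 0, x = 1 | x = - 1]) -> ring_iso A 'F_3.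
Proof.
move=> A1 A3 AP; have [f fE] := @ord_cast_morph 1 A A3.
have m1 : 2%:R = - 1 :> A by apply/eqP; rewrite -addr_eq0 -[1]/(1%:R) -natrD A3.
apply: ring_iso_sym; apply: (@ring_iso_inj_surj _ _ (f : {rmorphism 'F_3 -> A})) => [x|y].
  rewrite fE /ord_cast; case: x => [[|[|[|//]]]] //= lt3 /eqP; first by move=> _; apply: val_inj.
    by rewrite (negPf A1).
  by rewrite m1 oppr_eq0 (negPf A1).
have [->|->|->] := AP y; first by exists 0; rewrite rmorph0.
  by exists 1; rewrite rmorph1.
by exists (- 1); rewrite rmorphN rmorph1.
Qed.

Lemma iso_F2 (A : pzRingType) : 1 != 0 :> A -> 2%:R = 0 :> A ->
  (forall x : A, x = 0 \/ x = 1) -> ring_iso A 'F_2.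
Proof.
move=> A1 A2 AP; have [f fE] := @ord_cast_morph 0 A A2.
apply: ring_iso_sym; apply: (@ring_iso_inj_surj _ _ (f : {rmorphism 'F_2 -> A})) => [x|y].
  rewrite fE /ord_cast; case: x => [[|[|//]]] //= lt2 /eqP; first by move=> _; apply: val_inj.
  by rewrite (negPf A1).
by have [->|->] := AP y; [exists 0; rewrite rmorph0 | exists 1; rewrite rmorph1].
Qed.

Section ConnectedDelta.
Variables (A : comPzRingType) (s : seq A).
Hypothesis sA : forall x, x \in s.
Hypothesis A1 : 1 != 0 :> A.
Hypothesis A_conn : forall f : A, f * f = f -> f = 0 \/ f = 1.
Hypothesis AD : Delta_ring 2 A.

Let A_local (x : A) : x * (x + 2%:R) = 0 \/ x ^+ 2 = 1.
Proof.
have [[n xn0]|/AD x2] := nilp_or_unit sA A_conn x; last by right.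
by left; apply: Delta2_nilp xn0.
Qed.

Lemma connected_iso_F3 : is_unit (2%:R : A) -> ring_iso A 'F_3.
Proof.
move=> /AD two2; have three0 : 3%:R = 0 :> A.
  by rewrite (_ : 3%:R = 2%:R ^+ 2 - 1 :> A); [rewrite two2 subrr | ring].
(* A nilpotent x satisfies x^2 = -2x, which is x because 3 = 0; an element both idempotent and
   nilpotent is 0. *)
have nilp0 (x : A) n : x ^+ n = 0 -> x = 0.
  move=> xn0; have xx : x * x = x.
    have := Delta2_nilp AD xn0; rewrite (_ : _ * _ = x * x - x + 3%:R * x); last by ring.
    by rewrite three0 mul0r addr0 => /eqP; rewrite subr_eq0 => /eqP.
  case: n xn0 => [/eqP|n]; first by rewrite expr0 (negPf A1).
  by elim: n => [|n IHn]; rewrite ?expr1 // !exprS mulrA xx -exprS.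
apply: iso_F3 => // x.
have [[n /nilp0->]|/AD x2] := nilp_or_unit sA A_conn x; first by constructor 1.
(* The factor x - 1 is either 0 or a unit that can be cancelled, whence x = 1 or x = -1. *)
have x1 : (x - 1) * (x + 1) = 0 by rewrite -subr_sqr_1 x2 subrr.
have [[n /nilp0/eqP]|[y [_ yx]]] := nilp_or_unit sA A_conn (x - 1).
  by rewrite subr_eq0 => /eqP->; constructor 2.
constructor 3; apply/eqP; rewrite -addr_eq0; apply/eqP.
by rewrite -[x + 1]mul1r -{1}yx -mulrA x1 mulr0.
Qed.

Lemma connected_truncated : 2%:R = 0 :> A ->
  exists l, (0 < l)%N /\ quotient_of (truncated_poly_F2 l) A.
Proof.
(* The variables go to all elements of square zero; 0 is one of them, so the number of variables is
   positive. *)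
move=> two0; pose t := [seq x <- s | x ^+ 2 == 0].
have t0 (x : A) : x ^+ 2 = 0 -> x \in t by move=> /eqP x0; rewrite mem_filter x0 sA.
exists (size t); split; first by case: (t) (t0 0 (expr0n _ 2)).
have [f fE] := @ord_cast_morph 0 A two0.
have [F [_ FX]] := mpoly_eval (n := size t) (f : {rmorphism 'F_2 -> A}) (fun i => nth 0 t i) A1.
have [_ [i ->]|G GE] := quot_lift (f := F) (S := fun y => exists i, y = 'X_i ^+ 2).
  rewrite rmorphXn FX; apply/eqP.
  by have := mem_nth 0 (ltn_ord i); rewrite {2}/t mem_filter => /andP[].
have G_surj (x : A) : x ^+ 2 = 0 -> exists y, G y = x.
  move=> /t0 xt; have lt_i : (index x t < size t)%N by rewrite index_mem.
  by exists (quot_pi _ 'X_(Ordinal lt_i)); rewrite GE FX nth_index.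
apply/quotient_of_surj; exists G => x.
have [|x2] := A_local x; first by rewrite two0 addr0 => /G_surj.
(* When x^2 = 1 and 2 = 0, the element x - 1 has square zero, hence is the image of a variable. *)
have [|y yE] := G_surj (x - 1).
  rewrite (_ : _ ^+ 2 = x ^+ 2 - 1 - 2%:R * (x - 1)); last by ring.
  by rewrite x2 two0 mul0r !subrr.
by exists (y + 1); rewrite rmorphD rmorph1 yE subrK.
Qed.

Lemma connected_unit_point : ~ is_unit (2%:R : A) ->
  exists l, quotient_of (unit_point_quotient 8 l) A.
Proof.
move=> two_nu; have [[k two_nil]|//] := nilp_or_unit sA A_conn 2%:R.
have eight0 : 8%:R = 0 :> A by rewrite -(Delta2_nilp AD two_nil); ring.
pose N (x : A) := x * (x + 2%:R) = 0.
(* The solutions of x(x + 2) = 0 form an ideal. Otherwise some z = a x + y has z^2 = 1; but x^2 =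
   -2x and y^2 = -2y make z^2 a multiple of 2, so 1 = z^6 is a multiple of 8, that is, 0. *)
have NMD a x y : N x -> N y -> N (a * x + y).
  move=> Nx Ny; have [//|xy1] := A_local (a * x + y).
  have xE : (a * x + y) ^+ 2 = 2%:R * (a * x * y - a ^+ 2 * x - y).
    rewrite (_ : _ ^+ 2 = a ^+ 2 * (x * (x + 2%:R)) + y * (y + 2%:R) +
      2%:R * (a * x * y - a ^+ 2 * x - y)); last by ring.
    by rewrite Nx Ny mulr0 !add0r.
  case/eqP: A1; rewrite -(expr1n A 3) -xy1 xE exprMn.
  by rewrite -natrX eight0 mul0r.
have N0 : N 0 by rewrite /N mul0r.
(* The variables go to all u with u^2 = 1; then u - 1 lies in [N], since (u - 1)(u + 1) = 0, and so
   [F] maps the whole ideal P into [N]. *)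
pose t := [seq x <- s | x ^+ 2 == 1].
have [f fE] := @ord_cast_morph 6 A eight0.
have [F [_ FX]] := mpoly_eval (n := size t) (f : {rmorphism 'Z_8 -> A}) (fun i => nth 0 t i) A1.
have N2 : N 2%:R by rewrite /N -eight0; ring.
have NX i : N (F ('X_i - 1)).
  rewrite /N rmorphB rmorph1 FX.
  have := mem_nth 0 (ltn_ord i); rewrite {2}/t mem_filter => /andP[/eqP x2 _].
  rewrite (_ : _ * _ = nth 0 t i ^+ 2 - 1); last by ring.
  by rewrite x2 subrr.
have NP r : unit_point_ideal r -> N (F r).
  move=> [n [a [b [bP ->]]]]; rewrite rmorph_sum; apply: (big_ind N) => // [x y Nx Ny|i _].
    by rewrite -[x]mul1r; apply: NMD.
  rewrite rmorphM -[_ * _]addr0; apply: NMD => //.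
  by have [->|[j ->]] := bP i; rewrite ?rmorph_nat.
have [_ [r [/NP Nr ->]]|G GE] := quot_lift (f := F)
    (S := fun y => exists r, unit_point_ideal r /\ y = r * (r + 2%:R)).
  by rewrite rmorphM rmorphD rmorph_nat.
have G_surj (x : A) : x ^+ 2 = 1 -> exists y, G y = x.
  move=> x2; have xt : x \in t by rewrite mem_filter x2 eqxx sA.
  have lt_i : (index x t < size t)%N by rewrite index_mem.
  by exists (quot_pi _ 'X_(Ordinal lt_i)); rewrite GE FX nth_index.
exists (size t); apply/quotient_of_surj; exists G => x.
have [Nx|/G_surj//] := A_local x.
(* For x in [N], (x + 1)^2 = x(x + 2) + 1 = 1, so x + 1 is the image of a variable. *)
have [|y yE] := G_surj (x + 1).
  rewrite (_ : _ ^+ 2 = x * (x + 2%:R) + 1); last by ring.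
  by rewrite Nx add0r.
by exists (y - 1); rewrite rmorphB rmorph1 yE addrK.
Qed.

End ConnectedDelta.

Lemma idem_quot_connected (R : comPzRingType) (e : R) : primitive_idem e ->
  let A := quot_ring (fun y => y = 1 - e) in
  1 != 0 :> A /\ forall f : A, f * f = f -> f = 0 \/ f = 1.
Proof.
move=> [ee e0 e_prim] A; split.
  apply: contra_neq e0 => /esym/eqP; rewrite eq_sym -(rmorph1 (quot_pi _)) => /eqP.
  by move/(quot_idem_eq0 _ ee).1; rewrite mul1r.
move=> f; have [r <-] := quot_pi_surj f => /eqP; rewrite -rmorphM -subr_eq0 -rmorphB => /eqP.
move/(quot_idem_eq0 _ ee).1; rewrite mulrBl => /eqP; rewrite subr_eq0 => /eqP rr.
(* If the class of r is idempotent, then r e is an idempotent of R below e, to which primitivity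
   applies. *)
have [||re0|re] := e_prim (r * e).
- by rewrite mulrACA ee.
- by rewrite -mulrA ee.
- by left; apply/(quot_idem_eq0 _ ee).
right; apply/eqP; rewrite -subr_eq0 -(rmorph1 (quot_pi _)) -rmorphB; apply/eqP.
by apply/(quot_idem_eq0 _ ee); rewrite mulrBl re mul1r subrr.
Qed.

(** * Classification of commutative rings *)

Lemma quot_finite (R : comPzRingType) (S : R -> Prop) (s : seq R) :
  (forall x, x \in s) -> forall y, y \in [seq quot_pi S x | x <- s].
Proof. by move=> sR y; have [x <-] := quot_pi_surj y; apply: map_f. Qed.

Lemma classification_algebra (k : fieldType) (R : comPzRingType) (iota : {rmorphism k -> R}) :
  finite_dimensional iota ->
  (Delta_ring 2 R <->
   exists (m : nat) (A : 'I_m -> comPzRingType),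
     (forall i, algebra_factor (A i)) /\ ring_iso R (prod_ring A)).
Proof.
move=> [n [e eP]]; split=> [RD | [m [A [AP /ring_iso_sym RA]]]]; last first.
  apply/exp6_eq4_Delta/(exp6_eq4_iso RA)/exp6_eq4_prod => i.
  have [/ring_iso_sym/exp6_eq4_iso|[l [_ /exp6_eq4_quotient]]] := AP i; apply.
    exact: exp6_eq4_F3.
  exact: exp6_eq4_truncated.
(* If R is nonzero, [iota] is injective, so nonzero scalars square to 1. Hence k has at most three
   elements, and R is finite. *)
have k01 (x : k) : 1 != 0 :> R -> [\/ x = 0, x = 1 | x = - 1].
  move=> R1; have iota0 y : iota y = 0 -> y = 0.
    have [//|y0] := eqVneq y 0 => iy0; case/eqP: R1.
    by rewrite -(rmorph1 iota) -(mulVf y0) rmorphM iy0 mulr0.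
  have [->|x0] := eqVneq x 0; first by constructor 1.
  have /RD : is_unit (iota x).
    by exists (iota x^-1); rewrite -!rmorphM mulfV ?mulVf ?rmorph1.
  rewrite -rmorphXn => /eqP; rewrite -subr_eq0 -(rmorph1 iota) -rmorphB => /eqP/iota0/eqP.
  by rewrite subr_eq0 sqrf_eq1 => /orP[]/eqP->; [constructor 2|constructor 3].
have [s sR] : exists s : seq R, forall x, x \in s.
  have [R0|R1] := eqVneq (1 : R) 0.
    by exists [:: 0] => x; rewrite inE -[x]mul1r R0 mul0r.
  (* An enumeration of k, with a repetition when 1 = -1. *)
  pose c3 : 'I_3 -> k := fun i => nth 0 [:: 0; 1; - 1] i.
  have c3_surj x : exists i, c3 i = x.
    by have [->|->|->] := k01 x R1; [exists (inord 0)|exists (inord 1)|exists (inord 2)];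
      rewrite /c3 inordK.
  exists [seq \sum_i iota (c3 (c i)) * e i | c : {ffun 'I_n -> 'I_3}] => x.
  have [c ->] := eP x; have /fin_all_exists[d dE] i := c3_surj (c i).
  apply/mapP; exists (finfun d); first by rewrite mem_enum.
  by apply: eq_bigr => i _; rewrite ffunE dE.
have [m [f [f_prim R_iso]]] := primitive_decomposition sR.
exists m, (fun i => quot_ring (fun y => y = 1 - f i)); split=> // i.
have [A1 A_conn] := idem_quot_connected (f_prim i); have [fi _ _] := f_prim i.
have AD := Delta_idem_quot fi RD; have sA := quot_finite (S := fun y => y = 1 - f i) sR.
set A := quot_ring _ in A1 A_conn AD sA *.
(* The characteristic of k decides the type of every factor: 2 is either 0 or invertible. *)
have [two0|two0] := eqVneq (2%:R : k) 0; [right | left].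
  apply: connected_truncated sA A1 A_conn AD _.
  by rewrite -(rmorph_nat (quot_pi _)) -(rmorph_nat iota) two0 !rmorph0.
apply: connected_iso_F3 sA A1 A_conn AD _.
exists (quot_pi _ (iota 2%:R^-1)); rewrite -(rmorph_nat (quot_pi _)) -(rmorph_nat iota).
by rewrite -!rmorphM mulfV ?mulVf ?rmorph1.
Qed.

Lemma classification_finite (R : finComPzRingType) :
  Delta_ring 2 R <->
  exists (m : nat) (A : 'I_m -> comPzRingType),
    (forall i, finite_ring_factor (A i)) /\ quotient_of (prod_ring A) R.
Proof.
split=> [RD | [m [A [AP RA]]]]; last first.
  apply/exp6_eq4_Delta/(exp6_eq4_quotient RA)/exp6_eq4_prod => i.
  have [[l [_]]||[l]|[l]] := AP i => /ring_iso_sym/exp6_eq4_iso; apply.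
  - exact: exp6_eq4_truncated.
  - exact: exp6_eq4_F3.
  - exact: exp6_eq4_unit_point.
  - exact: exp6_eq4_unit_point.
have sR (x : R) : x \in enum R by rewrite mem_enum.
have [m [f [f_prim R_iso]]] := primitive_decomposition sR.
pose A i := quot_ring (fun y => y = 1 - f i).
(* The factors can be presented one at a time, since a product of quotients is a quotient of the
   product. *)
suffices /fin_all_exists[B BP] i : exists B : comPzRingType,
    finite_ring_factor B /\ quotient_of B (A i).
  exists m, B; split=> [i|]; first by have [] := BP i.
  have /quotient_of_surj[F F_surj] : quotient_of (prod_ring B) (prod_ring A).
    by apply: quotient_of_prod => i; have [] := BP i.
  have [g [h hK gK]] := ring_iso_sym R_iso; apply/quotient_of_surj.
  exists (g \o F : {rmorphism prod_ring B -> R}) => y.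
  by have [x xE] := F_surj (h y); exists x; rewrite /= xE gK.
have [A1 A_conn] := idem_quot_connected (f_prim i); have [fi _ _] := f_prim i.
have AD := Delta_idem_quot fi RD; have sA := quot_finite (S := fun y => y = 1 - f i) sR.
have [two_u|two_nu] := EM (is_unit (2%:R : A i)).
  have A3 := connected_iso_F3 sA A1 A_conn AD two_u.
  exists 'F_3; split; first by constructor 2; exists idfun; exists idfun.
  by apply/quotient_of_surj; have [g [h hK gK]] := ring_iso_sym A3; exists g => y; exists (h y).
have [l lA] := connected_unit_point sA A1 A_conn AD two_nu.
exists (unit_point_quotient 8 l); split=> //.
by constructor 4; exists l; exists idfun; exists idfun.
Qed.

(** * Group rings *)

Section GroupRingMonomials.
Variables (R : pzRingType) (gT : finGroupType).
Implicit Types (a b : R) (x y : gT) (f : group_ring R gT).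

(** The element a x of the group ring, for a scalar a and a group element x. *)
Definition gmon a x : group_ring R gT := [ffun y => if y == x then a else 0].

Lemma gmonE a x y : gmon a x y = if y == x then a else 0.
Proof. by rewrite ffunE. Qed.

Lemma gmonM a b x y : gmon a x * gmon b y = gmon (a * b) (x * y)%g.
Proof.
apply/ffunP=> z; rewrite [LHS]ffunE gmonE (bigD1 x) //= !gmonE eqxx.
rewrite (can2_eq (mulKVg x) (mulKg x)) big1 => [|t /negPf tx]; last first.
  by rewrite gmonE tx mul0r.
by rewrite addr0; case: eqP => // _; rewrite mulr0.
Qed.

Lemma gmon1 : gmon 1 1%g = 1.
Proof. by apply/ffunP=> x; rewrite gmonE [RHS]ffunE; case: eqP. Qed.

Lemma gmonD a b x : gmon (a + b) x = gmon a x + gmon b x.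
Proof. by apply/ffunP=> y; rewrite [RHS]ffunE !gmonE; case: eqP => // _; rewrite addr0. Qed.

Lemma gmon0 x : gmon 0 x = 0.
Proof. by apply/ffunP=> y; rewrite gmonE [RHS]ffunE if_same. Qed.

Lemma gmon_sum f : f = \sum_x gmon (f x) x.
Proof.
apply/ffunP=> y; rewrite sum_ffunE (bigD1 y) //= gmonE eqxx big1 ?addr0 // => x.
by rewrite gmonE eq_sym => /negPf->.
Qed.

Lemma group_ring_coefD f1 f2 x : (f1 + f2 : group_ring R gT) x = f1 x + f2 x.
Proof. by rewrite ffunE. Qed.

Lemma group_ring_coefMn k f x : (k%:R * f) x = f x *+ k.
Proof.
rewrite mulr_natl; elim: k => [|k IHk]; first by rewrite !mulr0n [LHS]ffunE.
by rewrite !mulrS group_ring_coefD IHk.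
Qed.

Lemma gmonMn k a x : k%:R * gmon a x = gmon (k%:R * a) x.
Proof.
apply/ffunP=> y; rewrite group_ring_coefMn !gmonE mulr_natl.
by case: eqP => // _; rewrite mul0rn.
Qed.

End GroupRingMonomials.

Lemma group_ring_mulC (R : comPzRingType) (gT : finGroupType) :
  abelian [set: gT] -> commutative (@GRing.mul (group_ring R gT)).
Proof.
move=> abG f g; rewrite (gmon_sum f) (gmon_sum g) mulr_suml mulr_sumr.
apply: eq_bigr => x _; rewrite mulr_suml mulr_sumr; apply: eq_bigr => y _.
by rewrite !gmonM mulrC (centsP abG) ?inE.
Qed.

(** If 5 is prime to n, then n divides 5^2 - 1 = 24. Otherwise n = q m with q the 5-part of n, and
    the Chinese remainder theorem gives a unit congruent to 2 mod q and 1 mod m; its square is 4 mod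
    5, not 1. *)
Lemma Zp_units_sqr1_dvd24 n : (1 < n)%N ->
  (forall a b : 'Z_n, a * b = 1 -> a ^+ 2 = 1) -> (n %| 24)%N.
Proof.
move=> n1 sqr1; have n0 := ltnW n1.
have sqr a : coprime n a -> (a ^ 2 = 1 %[mod n])%N.
  rewrite -(unitZpE _ n1) => ua.
  have := sqr1 _ _ (mulrV ua); rewrite -natrX => /(congr1 val).
  by rewrite /= val_Zp_nat // Zp_cast.
have [n5|] := boolP (coprime n 5).
  by have /eqP := sqr 5 n5; rewrite eqn_mod_dvd.
rewrite coprime_sym prime_coprime // negbK => n5.
have [m m5 nE] := pfactor_coprime (isT : prime 5) n0; set q := (5 ^ _)%N in nE.
have q5 : (5 %| q)%N by rewrite dvdn_exp // logn_gt0 mem_primes n0 n5.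
have qm : coprime q m by rewrite coprimeXl.
pose a := chinese q m 2 1.
have /sqr a2 : coprime n a.
  rewrite nE coprimeMl -coprime_modr chinese_modr // coprime_modr coprimen1 /=.
  by rewrite -coprime_modr chinese_modl // coprime_modr coprimeXl.
have : (a ^ 2 == 1 %[mod 5])%N.
  by apply/eqP; rewrite -(modn_dvdm _ n5) a2 modn_dvdm.
by rewrite -modnXm -(modn_dvdm a q5) chinese_modl // modn_dvdm.
Qed.

Section BadUnits.
Variable S : comPzRingType.
Implicit Types G H : S.

Lemma Delta2_mod24 G : 24%:R = 0 :> S -> G ^+ 2 = 1 -> Delta_ring 2 S ->
  12%:R + 12%:R * G = 0.
Proof.
(* 18 is 2 mod 8 and 0 mod 3, so u is 2 + G mod 8 and G mod 3. The conclusion says u^2 - 1 = 0, and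
   u is a unit because u^4 = 1. *)
move=> S24 G2 SD; pose u := 18%:R + G.
have u2 : u ^+ 2 = 13%:R + 12%:R * G.
  rewrite (_ : _ ^+ 2 = 13%:R + 12%:R * G + 24%:R * (13%:R + G) + (G ^+ 2 - 1)).
    by rewrite G2 S24 mul0r subrr !addr0.
  by rewrite /u; ring.
have u4 : u ^+ 4 = 1.
  rewrite -[4%N]/(2 * 2)%N exprM u2.
  rewrite (_ : _ ^+ 2 = 1 + 24%:R * (7%:R + 13%:R * G + 6%:R * G ^+ 2)); last by ring.
  by rewrite S24 mul0r addr0.
have /SD : is_unit u by exists (u ^+ 3); rewrite -exprS -exprSr.
rewrite u2 => /(congr1 (fun x => x - 1)); rewrite subrr => <-; ring.
Qed.

Lemma Delta2_mod12 G H : 12%:R = 0 :> S -> G ^+ 2 = 1 -> H ^+ 2 = 1 ->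
  Delta_ring 2 S -> 6%:R + 6%:R * (G + H + G * H) = 0.
Proof.
(* 9 is 1 mod 4 and 0 mod 3, so u is 1 + G + H mod 4 and 1 mod 3. Again u^4 = 1, and the conclusion
   is u^2 - 1 = 0. *)
move=> S12 G2 H2 SD; pose u := 1 + 9%:R * (G + H); pose s := G + H + G * H.
have u2 : u ^+ 2 = 7%:R + 6%:R * s.
  rewrite (_ : _ ^+ 2 = 7%:R + 6%:R * s + 12%:R * (13%:R + G + H + 13%:R * (G * H))
    + 81%:R * (G ^+ 2 - 1) + 81%:R * (H ^+ 2 - 1)).
    by rewrite G2 H2 S12 mul0r subrr mulr0 !addr0.
  by rewrite /u /s; ring.
have u4 : u ^+ 4 = 1.
  rewrite -[4%N]/(2 * 2)%N exprM u2.
  rewrite (_ : _ ^+ 2 = 1 + 12%:R * (4%:R + 7%:R * s + 3%:R * s ^+ 2)); last by ring.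
  by rewrite S12 mul0r addr0.
have /SD : is_unit u by exists (u ^+ 3); rewrite -exprS -exprSr.
rewrite u2 => /(congr1 (fun x => x - 1)); rewrite subrr => <-; rewrite /s; ring.
Qed.

End BadUnits.

Lemma abelem_group_ring_exp4 n (gT : finGroupType) : n \in [:: 2; 3; 6]%N ->
  (2.-abelem [set: gT])%g -> forall f : group_ring 'Z_n gT, f ^+ 4 = f ^+ 2.
Proof.
move=> n236 /(abelemP (isT : prime 2))[abel sqr1].
have {}sqr1 (x : gT) : (x * x)%g = 1%g by rewrite -(sqr1 x) ?inE.
have cube (a : 'Z_n) : a ^+ 3 = a.
  apply/eqP; move: n236 a; rewrite !inE => /or3P[]/eqP->; case; do 6?[case=> //].
have sqr3 (a : 'Z_n) : 3%:R * a ^+ 2 = 3%:R * a.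
  apply/eqP; move: n236 a; rewrite !inE => /or3P[]/eqP->; case; do 6?[case=> //].
have c3 (a : 'Z_n) : 3%:R * gmon (a ^+ 2) (1%g : gT) = 3%:R * gmon a 1%g.
  by rewrite !gmonMn sqr3.
pose S : comPzRingType := HB.pack (group_ring 'Z_n gT)
  (GRing.PzRing_hasCommutativeMul.Build (group_ring 'Z_n gT) (group_ring_mulC abel)).
have Z6 : 6%:R = 0 :> 'Z_n by apply/val_inj; move: n236; rewrite !inE => /or3P[]/eqP->.
have S6 : 6%:R = 0 :> S.
  by apply/ffunP=> x; rewrite -[6%:R]mulr1 [LHS]group_ring_coefMn -mulr_natr Z6 mulr0 [RHS]ffunE.
pose c (a : 'Z_n) : S := gmon a 1%g.
(* Cross terms in 3(x + y)^2 and 2(x + y)^3 are multiples of 6, so [P] reduces to monomials a g.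
   There g^2 = 1 makes 3(a g)^2 a scalar, and a^3 = a gives the cubic condition. *)
pose P (f : S) := (exists a, 3%:R * f ^+ 2 = 3%:R * c a) /\ 2%:R * f ^+ 3 = 2%:R * f.
have Pall f : P f.
  rewrite (gmon_sum f); apply: (big_ind P) => [|x y [[a x2] x3] [[b y2] y3]|x _].
  - by split; [exists 0; rewrite /c gmon0 |]; rewrite expr0n.
  - split; [exists (a + b) |].
      rewrite /c gmonD mulrDr -x2 -y2.
      rewrite (_ : 3%:R * (x + y) ^+ 2 = 3%:R * x ^+ 2 + 3%:R * y ^+ 2 + 6%:R * (x * y)).
        by rewrite S6 mul0r addr0.
      ring.
    rewrite mulrDr -x3 -y3.
    rewrite (_ : 2%:R * (x + y) ^+ 3 =
      2%:R * x ^+ 3 + 2%:R * y ^+ 3 + 6%:R * (x ^+ 2 * y + x * y ^+ 2)).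
      by rewrite S6 mul0r addr0.
    ring.
  split; first by exists (f x ^+ 2); congr (_ * _); rewrite expr2 gmonM sqr1.
  by congr (_ * _); rewrite !exprS expr0 mulr1 !gmonM sqr1 mulg1 -expr2 -exprS cube.
move=> f; have [[a f2] f3] := Pall f.
suffices : (f : S) ^+ 4 - (f : S) ^+ 2 = 0 by move/eqP; rewrite subr_eq0 => /eqP.
(* Since 9 = 3 modulo 6, 3f^4 = (3f^2)^2 = 3c^2 for the scalar c with 3f^2 = 3c, and 3c^2 = 3c. *)
have f4 : 3%:R * (f : S) ^+ 4 = 3%:R * c a.
  have -> : 3%:R * (f : S) ^+ 4 = (3%:R * (f : S) ^+ 2) ^+ 2 - 6%:R * (f : S) ^+ 4 by ring.
  rewrite f2 S6 mul0r subr0.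
  have -> : (3%:R * c a) ^+ 2 = 3%:R * (c a) ^+ 2 + 6%:R * (c a) ^+ 2 by ring.
  rewrite S6 mul0r addr0 expr2 /c gmonM mulg1 -expr2.
  exact: c3.
have -> : (f : S) ^+ 4 - (f : S) ^+ 2 =
  3%:R * f ^+ 4 - 3%:R * f ^+ 2 - f * (2%:R * f ^+ 3 - 2%:R * f) by ring.
by rewrite f4 f2 f3 !subrr mulr0 subrr.
Qed.

(** For a + b g with g^2 = 1, the images under g = 1 and g = -1 are a + b and a - b, and the
    conclusion lists the coefficients of (a + b g)^2 = 1. *)
Lemma Z12_unit_pair n (a b : 'Z_n) : n \in [:: 4; 12]%N ->
  (exists c, (a + b) * c = 1) -> (exists c, (a - b) * c = 1) ->
  a * a + b * b = 1 /\ a * b + b * a = 0.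
Proof.
move=> n4 u1 u2.
have sqr (x : 'Z_n) : (exists c, x * c = 1) -> x ^+ 2 == 1.
  move=> [c xc]; have x42 : x ^+ 4 = x ^+ 2.
    by apply/eqP; move: n4 {u1 u2 xc} x; rewrite !inE => /orP[]/eqP->; case; do 12?[case=> //].
  apply/eqP; have xc2 : x ^+ 2 * c ^+ 2 = 1 by rewrite -exprMn xc expr1n.
  by rewrite -[LHS]mulr1 -xc2 mulrA -exprD x42.
suffices /implyP/(_ (sqr _ u1))/implyP/(_ (sqr _ u2))/andP[/eqP-> /eqP->] :
    ((a + b) ^+ 2 == 1) ==> ((a - b) ^+ 2 == 1) ==>
    (a * a + b * b == 1) && (a * b + b * a == 0) by [].
rewrite -(valZpK a) -(valZpK b).
have iotaP (x : 'Z_n) : (x : nat) \in iota 0 (Zp_trunc n).+2 by rewrite mem_iota ltn_ord.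
pose P (i j : nat) := let a : 'Z_n := inZp i in let b : 'Z_n := inZp j in
   ((a + b) ^+ 2 == 1) ==> ((a - b) ^+ 2 == 1) ==>
    (a * a + b * b == 1) && (a * b + b * a == 0).
(* As 2 is not invertible, the sum and difference of the two squares do not give the claim directly;
   all pairs of residues are checked by computation. *)
suffices : all (fun i => all (P i) (iota 0 (Zp_trunc n).+2)) (iota 0 (Zp_trunc n).+2).
  by move/allP/(_ _ (iotaP a))/allP/(_ _ (iotaP b)).
by move: @P {a b u1 u2 sqr iotaP}; move: n4; rewrite !inE => /orP[]/eqP-> P; vm_compute.
Qed.

Lemma Delta_group_ring_C2 n (gT : finGroupType) : n \in [:: 4; 12]%N ->
  #|gT| = 2%N -> Delta_ring 2 (group_ring 'Z_n gT).
Proof.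
move=> n4 gT2.
have [g g1] : exists g : gT, g != 1%g.
  apply/existsP; rewrite -[[exists _, _]]negbK negb_exists; apply/negP => /forallP all1.
  have : (#|gT| <= #|pred1 (1%g : gT)|)%N.
    by apply/subset_leq_card/subsetP => x _; have := all1 x; rewrite negbK.
  by rewrite card1 gT2.
have gTE (x : gT) : (x == 1%g) || (x == g).
  have /subsetP/(_ x) : gT \subset pred2 1%g g; last by apply.
  by rewrite -(subset_leqif_card (subset_predT _)).2 card2 (eq_sym 1%g) g1 gT2.
have gg : (g * g)%g = 1%g.
  by have /orP[/eqP//|/eqP/(canRL (mulKg g))] := gTE (g * g)%g; rewrite mulVg => /eqP; rewrite (negPf g1).
have gV : (g^-1)%g = g by apply/eqP; rewrite eq_invg_mul gg.
have sum2 (F : gT -> 'Z_n) : \sum_x F x = F 1%g + F g.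
  rewrite (bigD1 1%g) //= (bigD1 g) //= big1 ?addr0 // => x.
  by case/andP => /negPf x1 /negPf xg; have := gTE x; rewrite x1 xg.
have mul_1 (u v : group_ring 'Z_n gT) : (u * v) 1%g = u 1%g * v 1%g + u g * v g.
  by rewrite [LHS]ffunE sum2 invg1 !mulg1 gV.
have mul_g (u v : group_ring 'Z_n gT) : (u * v) g = u 1%g * v g + u g * v 1%g.
  by rewrite [LHS]ffunE sum2 invg1 mul1g mulVg.
move=> u [v [uv _]]; have := mul_1 u v; have := mul_g u v.
rewrite uv -gmon1 !gmonE eqxx (negPf g1) => v0 v1.
(* Adding and subtracting the two coordinates of u v = 1 exhibits the inverses of both images. *)
have [||u1 ug] := @Z12_unit_pair n (u 1%g) (u g) n4.
- by exists (v 1%g + v g); rewrite v1 -[RHS]addr0 v0; ring.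
- by exists (v 1%g - v g); rewrite v1 -[RHS]subr0 v0; ring.
rewrite expr2; apply/ffunP=> x; rewrite gmonE.
case/orP: (gTE x) => /eqP->; first by rewrite eqxx mul_1.
by rewrite (negPf g1) mul_g.
Qed.

(** The hypotheses leave out cases where the equivalence fails: the zero ring for n = 1, and, for
    the trivial group, Z_n with n in {4, 8, 12, 24}, whose units square to 1. *)
Lemma classification_group_ring (n : nat) (gT : finGroupType) :
  (1 < n)%N ->
  ~ (#|gT| = 1%N /\ n \in [:: 4; 8; 12; 24]%N) ->
  (Delta_ring 2 (group_ring 'Z_n gT) <->
   (n \in [:: 2; 3; 6]%N /\ (2.-abelem [set: gT])%g) \/
   (n \in [:: 4; 12]%N /\ ([set: gT] \isog Zp 2)%g)).
Proof.
move=> n1 not_triv; split; last first.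
  case=> [[n236 abG] u [v [uv vu]] | [n4 /card_isog]]; last first.
    by rewrite cardsT card_Zp //; apply: Delta_group_ring_C2.
  have uv2 : u ^+ 2 * v ^+ 2 = 1 by rewrite -exprMn_comm ?uv ?expr1n // /GRing.comm uv.
  by rewrite -[LHS]mulr1 -uv2 mulrA -exprD abelem_group_ring_exp4.
move=> RD; have scalar2 (a b : 'Z_n) : a * b = 1 -> a ^+ 2 = 1.
  move=> ab; have /RD : is_unit (gmon a (1%g : gT)).
    by exists (gmon b 1%g); rewrite !gmonM mulg1 ab mulrC ab gmon1.
  by rewrite expr2 gmonM mulg1 -gmon1 => /ffunP/(_ 1%g); rewrite !gmonE eqxx.
have one0 : (1 : 'Z_n) != 0 by exact: oner_neq0.
have sqr1 (x : gT) : (x * x)%g = 1%g.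
  have /RD : is_unit (gmon (1 : 'Z_n) x).
    by exists (gmon 1 x^-1%g); rewrite !gmonM mulgV mulVg mulr1 gmon1.
  rewrite expr2 gmonM mulr1 -gmon1 => /ffunP/(_ 1%g); rewrite !gmonE eqxx.
  by case: eqP => [// | _ /eqP]; rewrite eq_sym (negPf one0).
have abelG : (2.-abelem [set: gT])%g.
  by apply: exponent2_abelem; apply/exponentP => x _; rewrite expg2; apply: sqr1.
have abG := abelem_abelian abelG.
have coef0 k (f : group_ring 'Z_n gT) x : x != 1%g -> k%:R + k%:R * f = 0 -> f x *+ k = 0.
  move=> x1 /ffunP/(_ x); rewrite -[X in X + _]mulr1 group_ring_coefD !group_ring_coefMn.
  by rewrite -gmon1 gmonE (negPf x1) mul0rn add0r [RHS]ffunE.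
have S0 k : k%:R = 0 :> 'Z_n -> k%:R = 0 :> group_ring 'Z_n gT.
  by move=> k0; rewrite -[k%:R]mulr1 -[X in _ * X]gmon1 gmonMn mulr1 k0 gmon0.
pose S : comPzRingType := HB.pack (group_ring 'Z_n gT)
  (GRing.PzRing_hasCommutativeMul.Build (group_ring 'Z_n gT) (group_ring_mulC abG)).
have SD : Delta_ring 2 S := RD.
have gmon_sqr (x : gT) : (gmon 1 x : S) ^+ 2 = 1 by rewrite expr2 gmonM mulr1 sqr1 gmon1.
have n_div : n \in divisors 24 by rewrite -dvdn_divisors //; apply: Zp_units_sqr1_dvd24.
have [n236|n236] := boolP (n \in [:: 2; 3; 6]%N); first by left.
have n_big : n \in [:: 4; 8; 12; 24]%N.
  have /allP/(_ n n_div) : all (fun m => (1 < m)%N ==> (m \notin [:: 2; 3; 6]%N) ==>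
    (m \in [:: 4; 8; 12; 24]%N)) (divisors 24) by [].
  by rewrite n1 n236.
have [g g1] : exists g : gT, g != 1%g.
  apply/existsP; rewrite -[[exists _, _]]negbK negb_exists; apply/negP => /forallP all1.
  case: not_triv; split=> //; apply: (@eq_card1 _ 1%g) => x.
  by have := all1 x; rewrite negbK.
right; have [n4|n4] := boolP (n \in [:: 4; 12]%N); last first.
  have n8 : n \in [:: 8; 24]%N.
    by move: n_big n4; rewrite !inE; case: eqP; case: eqP; case: eqP; case: eqP.
  have Z24 : 24%:R = 0 :> 'Z_n by apply/val_inj; move: n8; rewrite !inE => /orP[]/eqP->.
  (* The coefficient of 12 + 12g at g is 12, nonzero mod 8 and mod 24. *)
  have /(coef0 _ _ _ g1) := @Delta2_mod24 S (gmon 1 g) (S0 _ Z24) (gmon_sqr g) SD.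
  by rewrite gmonE eqxx => /(congr1 val); move: n8; rewrite !inE => /orP[]/eqP->.
have gT2 : #|gT| = 2%N.
  have [h /andP[h1 hg]|gT_sub] := pickP (fun h => (h != 1%g) && (h != g)).
    have Z12 : 12%:R = 0 :> 'Z_n by apply/val_inj; move: n4; rewrite !inE => /orP[]/eqP->.
    (* As h and gh differ from g, the coefficient at g is 6, nonzero mod 4 and mod 12. *)
    have /(coef0 _ _ _ g1) := @Delta2_mod12 S (gmon 1 g) (gmon 1 h) (S0 _ Z12) (gmon_sqr g) (gmon_sqr h) SD.
    rewrite gmonM mulr1 !group_ring_coefD !gmonE eqxx eq_sym (negPf hg).
    rewrite -{1}[g]mulg1 (inj_eq (mulgI g)) eq_sym (negPf h1) !addr0 => /(congr1 val).
    by move: n4; rewrite !inE => /orP[]/eqP->.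
  rewrite -(@eq_card _ (pred2 1%g g)) ?card2 ?(eq_sym 1%g) ?g1 // => x.
  by rewrite !inE; move: (gT_sub x); case: eqP; case: eqP.
split=> //; rewrite isog_cyclic_card; last by rewrite prime_cyclic ?cardsT ?gT2.
by rewrite prime_cyclic card_Zp // cardsT gT2.
Qed.

(** * Path algebras *)

Section Paths.
Variable Q : quiver.
Implicit Types p q c : qpath Q.

Lemma path_arrows_nil p : path_arrows p = [::] -> p = trivial_path (path_start p).
Proof. by move=> p0; apply: val_inj; rewrite /= -p0 -surjective_pairing. Qed.

Lemma path_comp_trivial p q v :
  path_comp p q = Some (trivial_path v) -> p = trivial_path v /\ q = trivial_path v.
Proof.
have [pq|/path_comp_neq->//] := eqVneq (path_end q) (path_start p).
have [c -> cE] := path_compE pq => -[cv]; move: cE; rewrite cv /= => -[qv].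
case q_arr: (path_arrows q) => //= p_arr.
have qE := path_arrows_nil q_arr; have pE := path_arrows_nil (esym p_arr).
by rewrite pE -pq qE /= -qv.
Qed.

Lemma path_length2_prefix c : (1 < path_length c)%N -> exists p : qpath Q, path_length p = 2%N.
Proof.
rewrite /path_length /path_arrows; case: c => [[v [|a [|b s]]] //= w] _.
have w2 : is_walk v [:: a; b] by move: w; rewrite /= => /and3P[-> ->].
by exists (exist _ (v, [:: a; b]) w2).
Qed.

End Paths.

Section PathAlgebraCoef.
Variables (k : fieldType) (Q : quiver).
Local Notation kQ := (path_algebra k Q).
Implicit Types (f g : kQ) (p q : qpath Q) (x y : k) (v : vertex Q).

Definition pcoef p f : k := monalg.mcoeff p f.

Lemma pcoefD p f g : pcoef p (f + g) = pcoef p f + pcoef p g.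
Proof. exact: monalg.mcoeffD. Qed.

Lemma pcoef0 p : pcoef p 0 = 0.
Proof. exact: monalg.mcoeff0. Qed.

Lemma pcoef_inj f g : (forall p, pcoef p f = pcoef p g) -> f = g.
Proof. by move=> fg; apply/monalg.malgP. Qed.

Lemma pcoefU p q x : pcoef q (path_monomial x p) = if p == q then x else 0.
Proof. by rewrite unlock /pcoef monalg.mcoeffU; case: eqP. Qed.

Lemma pcoef_term q x o : pcoef q (path_term x o) = if o == Some q then x else 0.
Proof. by case: o => [p|]; [apply: pcoefU | apply: pcoef0]. Qed.

Lemma path_monomialM x y p q :
  path_monomial x p * path_monomial y q = path_term (x * y) (path_comp p q).
Proof. exact: path_mulUU. Qed.

(** Lengths add under composition, so e_v arises only as e_v e_v. *)
Lemma vcoefM v f g :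
  pcoef (trivial_path v) (f * g) = pcoef (trivial_path v) f * pcoef (trivial_path v) g.
Proof.
elim/path_algebra_ind: f => [|f1 f2 IH1 IH2|x p].
- by rewrite mul0r pcoef0 mul0r.
- by rewrite mulrDl !pcoefD mulrDl IH1 IH2.
elim/path_algebra_ind: g => [|g1 g2 IH1 IH2|y q].
- by rewrite mulr0 pcoef0 mulr0.
- by rewrite mulrDr !pcoefD mulrDr IH1 IH2.
rewrite path_monomialM pcoef_term !pcoefU.
have [->|pv] := eqVneq p (trivial_path v).
  rewrite path_comp1; have [->|qv] := eqVneq q (trivial_path v); first by rewrite !eqxx.
  by rewrite mulr0; case: (path_end q == v); rewrite // (inj_eq Some_inj) (negPf qv).
by rewrite mul0r; case: eqP => // /path_comp_trivial[/eqP]; rewrite (negPf pv).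
Qed.

(** The multiple of the identity by x, embedding k in the algebra when there is a vertex. *)
Definition path_scalar x : kQ := \sum_v path_monomial x (trivial_path v).

Lemma path_scalar1 : path_scalar 1 = 1.
Proof. by []. Qed.

Lemma path_scalarM x y : path_scalar x * path_scalar y = path_scalar (x * y).
Proof.
rewrite mulr_suml; apply: eq_bigr => v _; rewrite mulr_sumr (bigD1 v) //= big1 => [|w wv].
  by rewrite path_monomialM path_comp1 eqxx addr0.
by rewrite path_monomialM path_comp1 (negPf wv).
Qed.

Lemma vcoef_scalar v x : pcoef (trivial_path v) (path_scalar x) = x.
Proof.
rewrite /path_scalar (big_morph _ (pcoefD _) (pcoef0 _)) (bigD1 v) //= pcoefU eqxx.
rewrite big1 ?addr0 // => w wv; rewrite pcoefU.
by case: eqP => // -[] /eqP; rewrite (negPf wv).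
Qed.

Lemma vcoef_unit v f : is_unit f -> is_unit (pcoef (trivial_path v) f).
Proof.
by move=> [g [fg gf]]; exists (pcoef (trivial_path v) g);
  rewrite -!vcoefM fg gf -path_scalar1 vcoef_scalar.
Qed.

Lemma Delta_path_scalars v : Delta_ring 2 kQ -> Delta_ring 2 k.
Proof.
move=> QD x [y [xy yx]]; have /QD : is_unit (path_scalar x).
  by exists (path_scalar y); rewrite !path_scalarM xy yx path_scalar1.
by rewrite expr2 path_scalarM -path_scalar1 => /(congr1 (pcoef (trivial_path v))); rewrite !vcoef_scalar.
Qed.

Lemma path_double0 f : 2%:R = 0 :> k -> f + f = 0.
Proof.
by move=> k2; apply: pcoef_inj => p; rewrite pcoefD pcoef0 -mulr2n -mulr_natl k2 mul0r.
Qed.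

Lemma Delta_path_arrow (a : arrow Q) : acyclic Q -> Delta_ring 2 kQ -> 2%:R = 0 :> k.
Proof.
move=> acQ QD; have wa : is_walk (source a) [:: a] by rewrite /= eqxx.
pose p : qpath Q := exist _ (source a, [:: a]) wa.
pose P : kQ := path_monomial 1 p.
(* By acyclicity the arrow is not a loop, so it cannot follow itself. *)
have PP : P * P = 0 by rewrite path_monomialM path_comp_neq //; apply/eqP/acQ.
have /QD : is_unit (1 + P).
  exists (1 - P); rewrite mulrBr mulrBl mulr1 mul1r mulrDl mulrDr mulr1 mul1r PP addr0.
  by rewrite addrK.
rewrite expr2 mulrDl mul1r mulrDr mulr1 PP addr0 => /eqP.
rewrite -subr_eq0 addrAC [1 + P]addrC addrK => /eqP/(congr1 (pcoef p)).
by rewrite pcoefD pcoefU eqxx pcoef0.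
Qed.

Lemma Delta_path_length2 p : acyclic Q -> Delta_ring 2 kQ -> 2%:R = 0 :> k ->
  path_length p <> 2%N.
Proof.
move=> acQ QD k2; have p_neq : (0 < path_length p)%N -> path_end p != path_start p.
  by move=> p0; apply/eqP/acQ.
case pE: p p_neq => [[v [|a [|b [|]]]] //= w] p_neq _; move: (w); rewrite /= andbT => /andP[/eqP av /eqP ba].
have wa : is_walk v [:: a] by rewrite /= av eqxx.
have wb : is_walk (target a) [:: b] by rewrite /= ba eqxx.
pose q1 : qpath Q := exist _ (v, [:: a]) wa; pose q2 : qpath Q := exist _ (target a, [:: b]) wb.
pose P1 : kQ := path_monomial 1 q1; pose P2 : kQ := path_monomial 1 q2.
pose W : kQ := path_monomial 1 p.
have nil (q : qpath Q) : path_end q != path_start q ->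
    path_monomial 1 q * path_monomial 1 q = 0 :> kQ.
  by move=> qq; rewrite path_monomialM path_comp_neq.
have P11 : P1 * P1 = 0 by apply/nil/eqP/acQ.
have P22 : P2 * P2 = 0 by apply/nil/eqP/acQ.
have WW : W * W = 0 by apply/nil; rewrite pE; apply: p_neq.
(* If [a] could follow [b], the path [p] would be a directed cycle. *)
have P12 : P1 * P2 = 0.
  by rewrite path_monomialM path_comp_neq //; apply: (p_neq isT).
have P21 : P2 * P1 = W.
  have [|c cE cv] := @path_compE Q q2 q1; first by [].
  by rewrite path_monomialM cE mulr1 /=; congr path_monomial; apply: val_inj; rewrite cv pE.
have sqr1 (X : kQ) : (1 + X) ^+ 2 = 1 + X * X.
  by rewrite expr2 mulrDl mul1r mulrDr mulr1 addrA -[1 + X + X]addrA path_double0 // addr0.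
have u2 : (1 + (P1 + P2)) ^+ 2 = 1 + W.
  by rewrite sqr1 mulrDl !mulrDr P11 P22 P12 P21 !addr0 add0r.
have u4 : (1 + (P1 + P2)) ^+ 4 = 1.
  by rewrite -[4%N]/(2 * 2)%N exprM u2 sqr1 WW addr0.
have /QD : is_unit (1 + (P1 + P2)).
  by exists ((1 + (P1 + P2)) ^+ 3); rewrite -exprS -exprSr.
rewrite u2 => /eqP; rewrite -subr_eq0 addrAC subrr add0r => /eqP/(congr1 (pcoef p)).
by rewrite pcoefU eqxx pcoef0 => /eqP; rewrite oner_eq0.
Qed.

(** All paths are trivial, so the algebra multiplies coordinatewise over the vertices. *)
Lemma trivial_quiver_Delta : Delta_ring 2 k -> trivial_quiver Q -> Delta_ring 2 kQ.
Proof.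
move=> kD Q0 u u_unit; apply: pcoef_inj => p.
have -> : p = trivial_path (path_start p).
  apply: path_arrows_nil; case: (path_arrows p) => // a s.
  by have := card0_eq Q0 a.
rewrite expr2 vcoefM -expr2 (kD _ (vcoef_unit _ u_unit)).
by rewrite -path_scalar1 vcoef_scalar.
Qed.

(** A unit u has coefficient 1 at every vertex, so u - 1 is supported on paths of positive length.
    Its square is 0: a nonzero product of two such paths would have a prefix of length 2. Hence u^2
    = 1 + 2(u - 1) = 1. *)
Lemma short_paths_Delta : (forall x, x = 0 \/ x = 1) -> 2%:R = 0 :> k ->
  (forall p, path_length p <> 2%N) -> Delta_ring 2 kQ.
Proof.
move=> k01 k2 Q2 u u_unit; pose r := u - 1.
have rv v : pcoef (trivial_path v) r = 0.
  have [//|u1] := k01 (pcoef (trivial_path v) r).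
  have := vcoef_unit v u_unit; rewrite -[u](subrK 1) -/r pcoefD u1 -path_scalar1 vcoef_scalar.
  rewrite -[1 + 1]/(2%:R) k2 => -[y [/eqP]]; by rewrite mul0r eq_sym oner_eq0.
have r_supp p : p \in monalg.msupp r -> (0 < path_length p)%N.
  rewrite -monalg.mcoeff_neq0 -/(pcoef p r) lt0n; apply: contraNN => /nilP/path_arrows_nil->.
  by rewrite rv.
have rr : r * r = 0.
  rewrite -[LHS]/(path_algebra_mul r r) [path_algebra_mul]unlock big_seq big1 // => p /r_supp p0.
  rewrite big_seq big1 // => q /r_supp q0.
  have [pq|/path_comp_neq->//] := eqVneq (path_end q) (path_start p).
  have [c _ cE] := path_compE pq; have [] := @path_length2_prefix Q c.
    by rewrite /path_length {1}/path_arrows cE size_cat; rewrite -addn1 leq_add.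
  by move=> d /Q2.
rewrite -[u](subrK 1) -/r addrC expr2 mulrDl mul1r mulrDr mulr1 rr addr0.
by rewrite -addrA path_double0 // addr0.
Qed.

End PathAlgebraCoef.

(** A vertex makes the scalars visible: with none, the algebra is zero and does not constrain k.
    With one, k is {0, 1, -1}, and whether 2 vanishes separates the two cases. *)
Lemma classification_path_algebra (k : fieldType) (Q : quiver) :
  (0 < #|vertex Q|)%N -> acyclic Q ->
  (Delta_ring 2 (path_algebra k Q) <->
   (ring_iso k 'F_3 /\ trivial_quiver Q) \/
   (ring_iso k 'F_2 /\ ~ exists p : qpath Q, path_length p = 2%N)).
Proof.
move=> /card_gt0P[v _] acQ; split=> [QD | [[k3 Q0] | [[f [g fK gK]] Q2]]]; last 2 first.
- apply: trivial_quiver_Delta Q0; apply: exp6_eq4_Delta.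
  exact: exp6_eq4_iso (ring_iso_sym k3) exp6_eq4_F3.
- apply: short_paths_Delta => [x||p p2]; last by apply: Q2; exists p.
    have [fx|fx] : f x = 0 \/ f x = 1.
    + by case: (f x); do 2?[case=> //]; [left | right]; apply: val_inj.
    + by left; rewrite -[x]fK fx -(rmorph0 f) fK.
    + by right; rewrite -[x]fK fx -(rmorph1 f) fK.
  by rewrite -[LHS]fK rmorph_nat -[RHS]fK rmorph0; congr g; apply: val_inj.
have kD := Delta_path_scalars v QD.
have kP (x : k) : [\/ x = 0, x = 1 | x = - 1].
  have [->|x0] := eqVneq x 0; first by constructor 1.
  have /kD/eqP : is_unit x by exists x^-1; rewrite mulfV ?mulVf.
  by rewrite sqrf_eq1 => /orP[]/eqP->; [constructor 2|constructor 3].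
have k1 := oner_neq0 k.
have [k2|k2] := eqVneq (2%:R : k) 0; [right | left]; split.
- apply: iso_F2 => // x; have kN1 : - 1 = 1 :> k.
    by apply/eqP; rewrite eq_sym -addr_eq0 -[1 + 1]/(2%:R) k2.
  by have [->|->|->] := kP x; rewrite ?kN1; auto.
- by move=> [p]; apply: Delta_path_length2 acQ QD k2.
- apply: iso_F3 => //; have [/eqP|/eqP|k2N] := kP 2%:R.
  + by rewrite (negPf k2).
  + by rewrite -[X in _ == X]addr0 -[2%:R]/(1 + 1) (inj_eq (addrI 1)) (negPf k1).
  + by rewrite mulrS k2N subrr.
apply/eqP; rewrite -leqn0 leqNgt; apply/negP => /card_gt0P[a _].
by case/eqP: k2; apply: (Delta_path_arrow a acQ QD).
Qed.

Theorem theorem1p1 :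
  [/\ forall (k : fieldType) (R : comPzRingType) (iota : {rmorphism k -> R}),
        finite_dimensional iota ->
        (Delta_ring 2 R <->
         exists (m : nat) (A : 'I_m -> comPzRingType),
           (forall i, algebra_factor (A i)) /\ ring_iso R (prod_ring A)),
      forall R : finComPzRingType,
        Delta_ring 2 R <->
        exists (m : nat) (A : 'I_m -> comPzRingType),
          (forall i, finite_ring_factor (A i)) /\ quotient_of (prod_ring A) R,
      (* Among n >= 1, the excluded pairs (n, G) are exactly the failures. *)
      forall (n : nat) (gT : finGroupType),
        (1 < n)%N ->
        ~ (#|gT| = 1%N /\ n \in [:: 4; 8; 12; 24]%N) ->
        (Delta_ring 2 (group_ring 'Z_n gT) <->
         (n \in [:: 2; 3; 6]%N /\ (2.-abelem [set: gT])%g) \/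
         (n \in [:: 4; 12]%N /\ ([set: gT] \isog Zp 2)%g))
    & forall (k : fieldType) (Q : quiver),
        (0 < #|vertex Q|)%N -> acyclic Q ->
        (Delta_ring 2 (path_algebra k Q) <->
         (ring_iso k 'F_3 /\ trivial_quiver Q) \/
         (ring_iso k 'F_2 /\ ~ exists p : qpath Q, path_length p = 2%N))].
Proof.
split; [exact: classification_algebra | exact: classification_finite
      | exact: classification_group_ring | exact: classification_path_algebra].
Qed.
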